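(* Let $K$ be a real valued field of characteristic different from $2$, let $0\le k\le n$, and let $K\langle x_1,\dots,x_n\rangle$ be the convergent power series ring over $K$ with maximal ideal $\mathfrak m=\langle x_1,\dots,x_n\rangle$. 1. Let $f_0,f_1\in\mathfrak m^2\subset K\langle x_1,\dots,x_n\rangle$ be of the form $$f_0=a_1x_1^2+\dots+a_kx_k^2+g_0(x_{k+1},\dots,x_n),\qquad f_1=a_1x_1^2+\dots+a_kx_k^2+g_1(x_{k+1},\dots,x_n)$$ with $a_i\in K$, $a_i\neq 0$, and $g_0,g_1\in\mathfrak m^3$. If $f_0$ and $f_1$ are right equivalent in $K\langle x_1,\dots,x_n\rangle$, then $g_0$ and $g_1$ are right equivalent in $K\langle x_{k+1},\dots,x_n\rangle$. 2. (i) Let $f\in\mathfrak m^2\subset K[[x_1,\dots,x_n]]$ with $\operatorname{rank}H(f)=k$. Then $f$ is right equivalent in $K[[x_1,\dots,x_n]]$ to $$a_1x_1^2+\dots+a_kx_k^2+g(x_{k+1},\dots,x_n)$$ with $a_i\in K$, $a_i\ne0$, and $g\in\mathfrak m^3$ (a formal power series in $x_{k+1},\dots,x_n$). The series $g$ (the residual part of $f$) is uniquely determined up to right equivalence in $K[[x_{k+1},\dots,x_n]]$. (ii) The same statement holds if $f\in\mathfrak m^2\subset K\langle x_1,\dots,x_n\rangle$ has an isolated singularity: $f$ is right equivalent in $K\langle x_1,\dots,x_n\rangle$ to such a sum with $k=\operatorname{rank}H(f)$ and $g\in K\langle x_{k+1},\dots,x_n\rangle\cap\mathfrak m^3$, and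 $g$ is unique up to right equivalence in $K\langle x_{k+1},\dots,x_n\rangle$.
   Context: A real valued field is a field $K$ with a map $|\ |:K\to\mathbb R_{\ge0}$ such that $|a|=0\Leftrightarrow a=0$, $|ab|=|a||b|$, $|a+b|\le|a|+|b|$ (not assumed complete; the trivial valuation is allowed). A formal power series $f=\sum_{\alpha\in\mathbb N^n}c_\alpha x^\alpha\in K[[x_1,\dots,x_n]]$ is convergent if there is $\varepsilon\in(\mathbb R_{>0})^n$ with $\sum_\alpha|c_\alpha|\varepsilon^\alpha<\infty$; $K\langle x_1,\dots,x_n\rangle$ denotes the local ring of convergent power series. For the trivial valuation it equals $K[[x_1,\dots,x_n]]$. In each power series ring $\mathfrak m$ denotes the maximal ideal generated by the variables. Two elements $f,g$ of a power series ring are right equivalent in that ring if there is a local $K$-algebra automorphism $\varphi$ of the ring (a substitution $x_i\mapsto\varphi_i$ with $\varphi_i\in\mathfrak m$ and invertible Jacobian determinant at $0$) with $\varphi(f)=g$. $H(f)=\big(\frac{\partial^2f}{\partial x_i\partial x_j}(0)\big)_{i,j=1,\dots,n}$ is the Hessian matrix at $0$. A series $f\in K\langle x_1,\dots,x_n\rangle$ has an isolated singularity if its Milnor number $\mu(f)=\dim_KK\langle x_1,\dots,x_n\rangle/\langle\frac{\partial f}{\partial x_1},\dots,\frac{\partial f}{\partial x_n}\rangle$ is finite. *)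

(* Defs.v *)
From HB Require Import structures.
From mathcomp Require Import all_boot all_order all_algebra.
From mathcomp Require Import boolp classical_sets cardinality fsbigop reals.
From mathcomp Require Import constructive_ereal ereal esum.

Set Implicit Arguments.
Unset Strict Implicit.
Unset Printing Implicit Defensive.

Import Order.TTheory GRing.Theory Num.Theory.

Local Open Scope classical_set_scope.
Local Open Scope ring_scope.

Definition midx (n : nat) := {ffun 'I_n -> nat}.

Section MultiIndex.
Variable n : nat.
Implicit Types a b c : midx n.

Definition munit (i : 'I_n) : midx n := [ffun j => (j == i : nat)].

Definition mbox a := {dffun forall i : 'I_n, 'I_(a i).+1}.
Definition mlow a (b : mbox a) : midx n := [ffun i => b i : nat].
Definition mhigh a (b : mbox a) : midx n := [ffun i => (a i - b i)%N].

Definition splits a : seq (midx n * midx n) :=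
  [seq (mlow b, mhigh b) | b : mbox a].

Lemma maddE a b i : (a + b) i = (a i + b i)%N.
Proof. by rewrite ffunE. Qed.

Lemma mem_splits a (p : midx n * midx n) : (p \in splits a) = (p.1 + p.2 == a).
Proof.
rewrite /splits; apply/fintype.imageP/eqP => [[b _ ->]|<-] /=.
  apply/ffunP => i; rewrite maddE !ffunE subnKC //.
  by rewrite -ltnS ltn_ord.
case: p => b c /=.
have le (i : 'I_n) : (b i < ((b + c)%R i).+1)%N by rewrite maddE ltnS leq_addr.
pose d : mbox (b + c) := [ffun i => Ordinal (le i)].
have dE i : d i = b i :> nat by exact: (congr1 val (ffunE _ i)).
exists d => //; congr (_, _); apply/ffunP => i; rewrite [RHS]ffunE dE //.
by rewrite maddE addKn.
Qed.

Lemma uniq_splits a : uniq (splits a).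
Proof.
rewrite /splits /image_mem map_inj_uniq ?enum_uniq // => b c [/ffunP bc _].
by apply/ffunP => i; apply/val_inj; have := bc i; rewrite !ffunE.
Qed.

Lemma maddI a : injective (+%R a).
Proof.
move=> b c /ffunP h; apply/ffunP => i.
by have := h i; rewrite !maddE => /addnI.
Qed.

End MultiIndex.

(** [K[[x_1, ..., x_n]]]; [coef f a] is the coefficient of [x^a]. *)
Record fps (K : fieldType) (n : nat) := Fps { coef : midx n -> K }.

HB.instance Definition _ K n := gen_eqMixin (fps K n).
HB.instance Definition _ K n := gen_choiceMixin (fps K n).

Section FormalRing.
Variables (K : fieldType) (n : nat).
Implicit Types f g h : fps K n.

Lemma fpsP f g : coef f =1 coef g <-> f = g.
Proof. by split=> [|->//]; case: f g => [f] [g] /= /funext ->. Qed.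

Definition fps_zero : fps K n := Fps (fun=> 0).
Definition fps_opp f := Fps (fun a => - coef f a).
Definition fps_add f g := Fps (fun a => coef f a + coef g a).
Definition fps_one : fps K n := Fps (fun a => (a == 0)%:R).
Definition fps_scale (c : K) f := Fps (fun a => c * coef f a).

(** Cauchy product: [b] ranges over the multi-indices with [b <= a], so that
    [(mlow b, mhigh b)] ranges over the pairs of multi-indices of sum [a]. *)
Definition fps_mul f g :=
  Fps (fun a => \sum_(b : mbox a) coef f (mlow b) * coef g (mhigh b)).

Lemma fps_mulE f g a :
  coef (fps_mul f g) a = \sum_(p <- splits a) coef f p.1 * coef g p.2.
Proof. by rewrite /splits /image_mem big_map big_enum. Qed.

Lemma fps_addA : associative fps_add.
Proof. by move=> f g h; apply/fpsP => a /=; rewrite addrA. Qed.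
Lemma fps_addC : commutative fps_add.
Proof. by move=> f g; apply/fpsP => a /=; rewrite addrC. Qed.
Lemma fps_add0 : left_id fps_zero fps_add.
Proof. by move=> f; apply/fpsP => a /=; rewrite add0r. Qed.
Lemma fps_addN : left_inverse fps_zero fps_opp fps_add.
Proof. by move=> f; apply/fpsP => a /=; rewrite addNr. Qed.

HB.instance Definition _ :=
  GRing.isZmodule.Build (fps K n) fps_addA fps_addC fps_add0 fps_addN.

Lemma fps_mulC : commutative fps_mul.
Proof.
move=> f g; apply/fpsP => a; rewrite !fps_mulE.
rewrite (perm_big [seq (p.2, p.1) | p <- splits a]) /=.
  by rewrite big_map; apply: eq_bigr => p _ /=; rewrite mulrC.
apply: uniq_perm; rewrite ?uniq_splits //.
  by rewrite map_inj_uniq ?uniq_splits // => -[? ?] [? ?] [-> ->].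
case=> b c; rewrite mem_splits; apply/eqP/mapP => [<-|[[b' c'] + [-> ->]]] /=.
  by exists (c, b) => //; rewrite mem_splits addrC.
by rewrite mem_splits addrC => /eqP.
Qed.

Lemma fps_mulA : associative fps_mul.
Proof.
move=> f g h; apply/fpsP => a; rewrite !fps_mulE.
under eq_bigr do rewrite fps_mulE mulr_sumr.
under [RHS]eq_bigr do rewrite fps_mulE mulr_suml.
pose L := [seq (p.1, q.1, q.2) | p <- splits a, q <- splits p.2].
pose M := [seq (q.1, q.2, p.2) | p <- splits a, q <- splits p.1].
pose F t := coef f t.1.1 * coef g t.1.2 * coef h t.2.
transitivity (\sum_(t <- L) F t).
  rewrite /L big_allpairs_dep; apply: eq_bigr => p _.
  by apply: eq_bigr => q _; rewrite /F mulrA.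
transitivity (\sum_(t <- M) F t); last first.
  by rewrite /M big_allpairs_dep.
apply: perm_big; apply: uniq_perm.
- apply: allpairs_uniq_dep => [|p _|]; rewrite ?uniq_splits //.
  move=> _ _ /allpairsPdep[p [q [_ + ->]]] /allpairsPdep[p' [q' [_ + ->]]].
  case: p p' q q' => [b c] [b' c'] [d e] [d' e'].
  by rewrite !mem_splits /= => /eqP <- /eqP <- [-> -> ->].
- apply: allpairs_uniq_dep => [|p _|]; rewrite ?uniq_splits //.
  move=> _ _ /allpairsPdep[p [q [_ + ->]]] /allpairsPdep[p' [q' [_ + ->]]].
  case: p p' q q' => [b c] [b' c'] [d e] [d' e'].
  by rewrite !mem_splits /= => /eqP <- /eqP <- [-> -> ->].
case=> [[b c] d]; apply/allpairsPdep/allpairsPdep => -[p [q []]].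
  rewrite !mem_splits => /eqP <- /eqP <- [-> -> ->].
  exists (p.1 + q.1, q.2), (p.1, q.1).
  by rewrite !mem_splits /= addrA !eqxx.
rewrite !mem_splits => /eqP <- /eqP <- [-> -> ->].
exists (q.1, q.2 + p.2), (q.2, p.2).
by rewrite !mem_splits /= addrA !eqxx.
Qed.

Lemma fps_mul1 : left_id fps_one fps_mul.
Proof.
move=> f; apply/fpsP => a; rewrite fps_mulE (bigD1_seq (0, a)) ?uniq_splits //=.
  rewrite eqxx mul1r big_seq_cond big1 ?addr0 // => -[b c].
  rewrite mem_splits /= => /andP[/eqP <- ne].
  have [b0|] := eqVneq b 0; last by rewrite mul0r.
  by rewrite b0 add0r eqxx in ne.
by rewrite mem_splits /= add0r.
Qed.

Lemma fps_mulDl : left_distributive fps_mul fps_add.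
Proof.
move=> f g h; apply/fpsP => a /=; rewrite -big_split.
by apply: eq_bigr => b _; rewrite mulrDl.
Qed.

Lemma fps_one_neq0 : fps_one != 0.
Proof.
apply/eqP => /fpsP /(_ 0) /= /eqP.
by rewrite eqxx (negPf (oner_neq0 _)).
Qed.

HB.instance Definition _ := GRing.Zmodule_isComNzRing.Build (fps K n)
  fps_mulA fps_mulC fps_mul1 fps_mulDl fps_one_neq0.

Lemma fps_scaleA c d f : fps_scale c (fps_scale d f) = fps_scale (c * d) f.
Proof. by apply/fpsP => a /=; rewrite mulrA. Qed.
Lemma fps_scale1 : left_id 1 fps_scale.
Proof. by move=> f; apply/fpsP => a /=; rewrite mul1r. Qed.
Lemma fps_scaleDr : right_distributive fps_scale +%R.
Proof. by move=> c f g; apply/fpsP => a /=; rewrite mulrDr. Qed.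
Lemma fps_scaleDl f : {morph fps_scale^~ f : c d / c + d}.
Proof. by move=> c d; apply/fpsP => a /=; rewrite mulrDl. Qed.

HB.instance Definition _ := GRing.Zmodule_isLmodule.Build K (fps K n)
  fps_scaleA fps_scale1 fps_scaleDr fps_scaleDl.

Lemma fps_scaleAl c f g : c *: (f * g) = (c *: f) * g.
Proof.
apply/fpsP => a /=; rewrite mulr_sumr.
by apply: eq_bigr => b _; rewrite mulrA.
Qed.

HB.instance Definition _ :=
  GRing.Lmodule_isLalgebra.Build K (fps K n) fps_scaleAl.
HB.instance Definition _ := GRing.Lalgebra_isComAlgebra.Build K (fps K n).

Lemma coef0 a : coef (0 : fps K n) a = 0. Proof. by []. Qed.
Lemma coef1 a : coef (1 : fps K n) a = (a == 0)%:R. Proof. by []. Qed.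
Lemma coefN f a : coef (- f) a = - coef f a. Proof. by []. Qed.
Lemma coefD f g a : coef (f + g) a = coef f a + coef g a. Proof. by []. Qed.
Lemma coefZ c f a : coef (c *: f) a = c * coef f a. Proof. by []. Qed.
Lemma coefM f g a :
  coef (f * g) a = \sum_(p <- splits a) coef f p.1 * coef g p.2.
Proof. exact: fps_mulE. Qed.

Definition fvar (i : 'I_n) : fps K n := Fps (fun a => (a == munit i)%:R).

(** The coefficient of [x^a] in [df/dx_i] is [(a_i + 1) c_(a + e_i)]. *)
Definition fderiv (i : 'I_n) f : fps K n :=
  Fps (fun a => coef f (a + munit i) *+ (a i).+1).

Definition hessian f : 'M[K]_n :=
  \matrix_(i, j) coef (fderiv i (fderiv j f)) 0.

End FormalRing.

Arguments fvar {K n} i.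

Record realValuation (R : realType) (K : fieldType) := RealValuation {
  rval :> K -> R;
  rval_ge0 : forall a, 0 <= rval a;
  rval_eq0 : forall a, rval a = 0 <-> a = 0;
  rvalM : forall a b, rval (a * b) = rval a * rval b;
  rvalD : forall a b, rval (a + b) <= rval a + rval b }.

Definition convergent (R : realType) (K : fieldType) (v : realValuation R K)
    (n : nat) (f : fps K n) : Prop :=
  exists2 eps : 'I_n -> R, (forall i, 0 < eps i) &
    (\esum_(a in [set: midx n])
        (v (coef f a) * \prod_(i < n) eps i ^+ a i)%:E < +oo)%E.

Section ConvergentSeries.
Variables (R : realType) (K : fieldType) (v : realValuation R K).

Lemma rval0 : v 0 = 0. Proof. exact/rval_eq0. Qed.

Lemma rval1 : v 1 = 1.
Proof.
have v1 : v 1 != 0.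
  by apply/eqP => /rval_eq0 /eqP; rewrite (negPf (oner_neq0 _)).
by apply: (mulfI v1); rewrite -rvalM !mulr1.
Qed.

Lemma rval_sum (I : Type) (s : seq I) (F : I -> K) :
  v (\sum_(i <- s) F i) <= \sum_(i <- s) v (F i).
Proof.
elim/big_rec2: _ => [|i y x _ le]; first by rewrite rval0.
by apply: (le_trans (rvalD _ _ _)); rewrite lerD2l.
Qed.

Lemma rvalMn x m : v (x *+ m) <= v x *+ m.
Proof.
elim: m => [|m IH]; first by rewrite !mulr0n rval0.
by rewrite !mulrS; apply: (le_trans (rvalD _ _ _)); rewrite lerD2l.
Qed.

Section Closure.
Variable n : nat.
Implicit Types (f g : fps K n) (eps : 'I_n -> R).

Definition mon eps (a : midx n) : R := \prod_(i < n) eps i ^+ a i.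

Lemma mon_ge0 eps a : (forall i, 0 < eps i) -> 0 <= mon eps a.
Proof. by move=> e0; apply: prodr_ge0 => i _; rewrite exprn_ge0 ?ltW. Qed.

Lemma monD eps a b : mon eps (a + b) = mon eps a * mon eps b.
Proof.
by rewrite /mon -big_split; apply: eq_bigr => i _; rewrite maddE exprD.
Qed.

Lemma le_mon eps eps' a : (forall i, 0 < eps i) ->
  (forall i, eps i <= eps' i) -> mon eps a <= mon eps' a.
Proof.
move=> e0 le; apply: ler_prod => i _.
rewrite (exprn_ge0 _ (ltW (e0 i))) /=.
by apply: lerXn2r; rewrite ?nnegrE ?(ltW (e0 i)) // (le_trans (ltW (e0 i))).
Qed.

Definition bounded_at f eps (M : R) :=
  forall s : seq (midx n), uniq s ->
    \sum_(a <- s) v (coef f a) * mon eps a <= M.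

Lemma bounded_at_ge0 f eps M : bounded_at f eps M -> 0 <= M.
Proof. by move=> /(_ [::] isT); rewrite big_nil. Qed.

Lemma bounded_at_le f eps eps' M : (forall i, 0 < eps i) ->
  (forall i, eps i <= eps' i) -> bounded_at f eps' M -> bounded_at f eps M.
Proof.
move=> e0 le bf s us; apply: le_trans (bf s us).
by apply: ler_sum => a _; rewrite ler_wpM2l ?rval_ge0 ?le_mon.
Qed.

Lemma convergentP f : convergent v f <->
  exists eps M, (forall i, 0 < eps i) /\ bounded_at f eps M.
Proof.
split=> [[eps e0 fin]|[eps [M [e0 bM]]]].
  exists eps, (fine (\esum_(a in [set: midx n]) (v (coef f a) * mon eps a)%:E)).
  split=> // s us; rewrite -lee_fin fineK; last first.
    rewrite ge0_fin_numE //; apply: esum_ge0 => a _.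
    by rewrite lee_fin mulr_ge0 ?rval_ge0 ?mon_ge0.
  rewrite -sumEFin; apply: esum_ge; exists [set` s].
    by split; [exact: finite_seq|].
  by rewrite fsbig_seq.
exists eps => //; apply: (@le_lt_trans _ _ M%:E); last by rewrite ltry.
apply: ge_ereal_sup => _ [A [finA _] <-].
rewrite fsbig_finite //= sumEFin lee_fin; apply: bM.
exact: finmap.fset_uniq.
Qed.

Lemma convergent_common f g : convergent v f -> convergent v g ->
  exists eps M N, [/\ forall i, 0 < eps i, bounded_at f eps M
                    & bounded_at g eps N].
Proof.
move=> /convergentP[e1 [M [e1_0 bf]]] /convergentP[e2 [N [e2_0 bg]]].
pose e i := Num.min (e1 i) (e2 i).
have e0 i : 0 < e i by rewrite lt_min e1_0 e2_0.
exists e, M, N; split=> //.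
- by apply: bounded_at_le bf => // i; rewrite ge_min lexx.
- by apply: bounded_at_le bg => // i; rewrite ge_min lexx orbT.
Qed.

Lemma convergent0 : convergent v (0 : fps K n).
Proof.
apply/convergentP; exists (fun=> 1), 0; split=> // s _.
by rewrite big1 // => a _; rewrite coef0 rval0 mul0r.
Qed.

Lemma convergentD f g :
  convergent v f -> convergent v g -> convergent v (f + g).
Proof.
move=> cf cg; have [eps [M [N [e0 bf bg]]]] := convergent_common cf cg.
apply/convergentP; exists eps, (M + N); split=> // s us.
apply: le_trans (lerD (bf s us) (bg s us)); rewrite -big_split /=.
by apply: ler_sum => a _; rewrite -mulrDl ler_wpM2r ?mon_ge0 ?rvalD.
Qed.

Lemma convergentZ c f : convergent v f -> convergent v (c *: f).
Proof.
move=> /convergentP[eps [M [e0 bf]]]; apply/convergentP.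
exists eps, (v c * M); split=> // s us.
apply: le_trans (ler_wpM2l (rval_ge0 v c) (bf s us)); rewrite mulr_sumr.
by apply: ler_sum => a _; rewrite coefZ rvalM mulrA.
Qed.

Lemma convergent_delta b : convergent v (Fps (fun a : midx n => (a == b)%:R)).
Proof.
apply/convergentP; exists (fun=> 1), 1; split=> // s us /=.
have mon1 a : mon (fun=> 1) a = 1.
  by rewrite /mon big1 // => i _; rewrite expr1n.
under eq_bigr do rewrite mon1 mulr1.
have [bs|bs] := boolP (b \in s).
  rewrite (bigD1_seq b) //= eqxx rval1 big1 ?addr0 // => a /negPf ->.
  exact: rval0.
rewrite big_seq big1 // => a as_; case: eqP => [ab|]; last by rewrite rval0.
by rewrite -ab as_ in bs.
Qed.

Lemma convergent1 : convergent v (1 : fps K n).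
Proof. exact: convergent_delta. Qed.

Lemma convergent_var i : convergent v (fvar i : fps K n).
Proof. exact: convergent_delta. Qed.

Lemma convergentM f g :
  convergent v f -> convergent v g -> convergent v (f * g).
Proof.
move=> cf cg; have [eps [M [N [e0 bf bg]]]] := convergent_common cf cg.
apply/convergentP; exists eps, (M * N); split=> // s us.
pose F a := v (coef f a) * mon eps a; pose G a := v (coef g a) * mon eps a.
have F0 a : 0 <= F a by rewrite mulr_ge0 ?rval_ge0 ?mon_ge0.
have G0 a : 0 <= G a by rewrite mulr_ge0 ?rval_ge0 ?mon_ge0.
pose L := [seq p | a <- s, p <- splits a].
have uL : uniq L.
  apply: allpairs_uniq_dep => [|a _|]; rewrite ?uniq_splits //.
  move=> _ _ /allpairsPdep[a [p [_ + ->]]] /allpairsPdep[a' [p' [_ + ->]]] /=.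
  by rewrite !mem_splits => /eqP <- /eqP <- ->.
pose B := undup [seq p.1 | p <- L]; pose C := undup [seq p.2 | p <- L].
apply: (@le_trans _ _ (\sum_(p <- L) F p.1 * G p.2)).
  rewrite big_allpairs_dep [leLHS]big_seq [leRHS]big_seq.
  apply: ler_sum => a _; rewrite coefM.
  apply: (le_trans (ler_wpM2r (mon_ge0 _ e0) (rval_sum _ _))).
  rewrite mulr_suml [leLHS]big_seq [leRHS]big_seq; apply: ler_sum => -[b c].
  rewrite mem_splits => /eqP <- /=.
  by rewrite monD rvalM /F /G mulrACA.
apply: (@le_trans _ _ (\sum_(p <- [seq (b, c) | b <- B, c <- C]) F p.1 * G p.2)).
  apply: (@le_trans _ _ (\sum_(p <- [seq (b, c) | b <- B, c <- C] | p \in L)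
      F p.1 * G p.2)); last first.
    rewrite [leRHS](bigID (mem L)) /= lerDl.
    by apply: sumr_ge0 => p _; rewrite mulr_ge0.
  rewrite -[leRHS]big_filter le_eqVlt; apply/orP; left; apply/eqP.
  apply: perm_big; apply: uniq_perm => //.
    apply: filter_uniq; apply: allpairs_uniq; rewrite ?undup_uniq //.
    by move=> [? ?] [? ?] _ _ [-> ->].
  move=> [b c]; rewrite mem_filter; case: (boolP (_ \in L)) => //= bcL.
  apply/esym/allpairsP; exists (b, c); rewrite !mem_undup; split=> //=.
    exact: (map_f fst bcL).
  exact: (map_f snd bcL).
rewrite big_allpairs_dep /=.
under eq_bigr do rewrite -mulr_sumr.
rewrite -mulr_suml ler_pM ?sumr_ge0 //.
  by apply: bf; rewrite undup_uniq.
by apply: bg; rewrite undup_uniq.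
Qed.

Lemma convergent_deriv i f : convergent v f -> convergent v (fderiv i f).
Proof.
move=> /convergentP[eps [M [e0 bf]]]; apply/convergentP.
pose e j := if j == i then eps i / 2 else eps j.
have ep j : 0 < e j by rewrite /e; case: ifP => _ //; rewrite divr_gt0.
exists e, ((eps i)^-1 * M); split=> // s us.
have us' : uniq [seq a + munit i | a <- s].
  by rewrite map_inj_uniq // => a b; rewrite ![_ + munit i]addrC => /maddI.
apply: le_trans (ler_wpM2l _ (bf _ us')); last by rewrite invr_ge0 ltW.
rewrite big_map mulr_sumr; apply: ler_sum => a _ /=.
have -> : mon eps (a + munit i) = eps i * mon eps a.
  rewrite monD mulrC; congr (_ * _); rewrite /mon (bigD1 i) //= ffunE eqxx.
  by rewrite big1 ?mulr1 // => j /negPf ji; rewrite ffunE ji.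
rewrite [leRHS]mulrCA mulKf ?gt_eqF //.
apply: (@le_trans _ _ (v (coef f (a + munit i)) *+ (a i).+1 * mon e a)).
  by rewrite ler_wpM2r ?mon_ge0 ?rvalMn.
rewrite -mulr_natr -mulrA ler_wpM2l ?rval_ge0 //.
rewrite /mon (bigD1 i) //= [leRHS](bigD1 i) //= mulrA.
have -> : \prod_(j < n | j != i) e j ^+ a j = \prod_(j < n | j != i) eps j ^+ a j.
  by apply: eq_bigr => j /negPf ji; rewrite /e ji.
rewrite ler_wpM2r ?prodr_ge0 // => [j _|]; first by rewrite exprn_ge0 ?ltW.
rewrite /e eqxx expr_div_n mulrCA ler_piMr ?exprn_ge0 ?(ltW (e0 i)) //.
by rewrite ler_pdivrMr ?exprn_gt0 // mul1r -natrX ler_nat ltn_expl.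
Qed.

End Closure.

Definition cps_pred n : {pred fps K n} := fun f => `[< convergent v f >].
Arguments cps_pred : clear implicits.

(** [K<x_1, ..., x_n>] as a subalgebra of [K[[x_1, ..., x_n]]]. *)
Record cps (n : nat) := Cps { cval : fps K n; _ : cval \in cps_pred n }.

HB.instance Definition _ n := [isSub for @cval n].
HB.instance Definition _ n := [Choice of cps n by <:].

Lemma cps_predP n (f : fps K n) : reflect (convergent v f) (f \in cps_pred n).
Proof. exact: asboolP. Qed.

Lemma cps_subalg n : GRing.subsemialg_closed (cps_pred n).
Proof.
split; first exact/cps_predP/convergent1.
- split; first exact/cps_predP/convergent0.
  by move=> f g /cps_predP cf /cps_predP cg; apply/cps_predP/convergentD.
- by move=> c f /cps_predP cf; apply/cps_predP/convergentZ.
- by move=> f g /cps_predP cf /cps_predP cg; apply/cps_predP/convergentM.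
Qed.

HB.instance Definition _ n :=
  GRing.SubChoice_isSubAlgebra.Build K (fps K n) (cps_pred n) (cps n)
    (cps_subalg n).
HB.instance Definition _ n := [SubNzRing_isSubComNzRing of cps n by <:].

Lemma cval_convergent n (f : cps n) : convergent v (cval f).
Proof. by case: f => f /= /cps_predP. Qed.

Definition to_cps n (f : fps K n) (cf : convergent v f) : cps n :=
  Cps (introT (cps_predP f) cf).

Definition cvar n (i : 'I_n) : cps n := to_cps (convergent_var i).

Definition cderiv n (i : 'I_n) (f : cps n) : cps n :=
  to_cps (convergent_deriv i (cval_convergent f)).

Lemma cval_zmod n : zmod_morphism (@cval n).
Proof. exact: (raddfB (val : cps n -> fps K n)). Qed.
Lemma cval_monoid n : monoid_morphism (@cval n).
Proof.
by split; [exact: (rmorph1 (val : cps n -> fps K n)) | exact: (rmorphM (val : cps n -> fps K n))].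
Qed.
Lemma cval_scalable n : scalable (@cval n).
Proof. exact: (linearZZ (val : cps n -> fps K n)). Qed.

HB.instance Definition _ n :=
  GRing.isZmodMorphism.Build (cps n) (fps K n) (@cval n) (@cval_zmod n).
HB.instance Definition _ n :=
  GRing.isMonoidMorphism.Build (cps n) (fps K n) (@cval n) (@cval_monoid n).
HB.instance Definition _ n :=
  GRing.isScalable.Build K (cps n) (fps K n) *:%R (@cval n) (@cval_scalable n).

End ConvergentSeries.

Arguments cvar {R K v n} i.

(** The first [k] of the [n] variables are indexed by [widen_ord hk i] with
    [i : 'I_k], the remaining ones by [last_ord hk j] with [j : 'I_(n - k)]. *)

Definition last_ord (k n : nat) (hk : (k <= n)%N) (j : 'I_(n - k)) : 'I_n :=
  cast_ord (subnKC hk) (rshift k j).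

Section Embedding.
Variables (R : realType) (K : fieldType) (v : realValuation R K).
Variables (k n : nat) (hk : (k <= n)%N).

Definition mfree (a : midx n) : bool :=
  [forall i : 'I_k, a (widen_ord hk i) == 0%N].
Definition mlast (a : midx n) : midx (n - k) := [ffun j => a (last_ord hk j)].

(** [K[[x_{k+1}, ..., x_n]]] into [K[[x_1, ..., x_n]]]: only monomials free of
    the first [k] variables ([mfree]) occur. *)
Definition fembed (g : fps K (n - k)) : fps K n :=
  Fps (fun a => if mfree a then coef g (mlast a) else 0).

Lemma big_first_last (F : 'I_n -> R) :
  \prod_i F i = (\prod_i F (widen_ord hk i)) * \prod_j F (last_ord hk j).
Proof.
rewrite (reindex (cast_ord (subnKC hk))) /=; last first.
  by exists (cast_ord (esym (subnKC hk))) => i _; rewrite ?cast_ordK ?cast_ordKV.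
rewrite big_split_ord /=; congr (_ * _).
by apply: eq_bigr => i _; congr F; apply/val_inj.
Qed.

Lemma mlast_inj : {in mfree &, injective mlast}.
Proof.
move=> a b /forallP a0 /forallP b0 /ffunP ab; apply/ffunP => i.
pose i' := cast_ord (esym (subnKC hk)) i.
have -> : i = cast_ord (subnKC hk) i' by rewrite cast_ordKV.
case: (splitP i') => j ij; last first.
  have -> : cast_ord (subnKC hk) i' = last_ord hk j by apply/val_inj.
  by have := ab j; rewrite !ffunE.
have -> : cast_ord (subnKC hk) i' = widen_ord hk j by apply/val_inj.
by rewrite (eqP (a0 j)) (eqP (b0 j)).
Qed.

Lemma convergent_embed (g : fps K (n - k)) :
  convergent v g -> convergent v (fembed g).
Proof.
move=> /convergentP[eps [M [e0 bg]]]; apply/convergentP.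
pose e i := if split (cast_ord (esym (subnKC hk)) i) is inr j then eps j else 1.
have e_last j : e (last_ord hk j) = eps j.
  by rewrite /e /last_ord cast_ordK (unsplitK (inr j)).
exists e, M; split=> [i|s us]; first by rewrite /e; case: split.
have um : uniq [seq mlast a | a <- s & mfree a].
  rewrite map_inj_in_uniq ?filter_uniq // => a b.
  by rewrite !mem_filter => /andP[fa _] /andP[fb _]; apply: mlast_inj.
apply: le_trans (bg _ um); rewrite big_map big_filter.
rewrite [leLHS](bigID mfree) /= [X in _ + X]big1 ?addr0; last first.
  by move=> a /negPf ->; rewrite rval0 mul0r.
apply: ler_sum => a fa; rewrite fa ler_wpM2l ?rval_ge0 //.
rewrite /mon big_first_last big1 ?mul1r => [|i _].
  by under eq_bigr do rewrite e_last; under [leRHS]eq_bigr do rewrite ffunE.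
by rewrite (eqP (forallP fa i)) expr0.
Qed.

Definition cembed (g : cps v (n - k)) : cps v n :=
  to_cps (convergent_embed (cval_convergent g)).

End Embedding.

Section Ideals.
Variable A : comNzRingType.

Definition ideal_gen (S : set A) : set A :=
  [set h | exists r (c s : 'I_r -> A),
     (forall j, S (s j)) /\ h = \sum_(j < r) c j * s j].

Definition ideal_mul (I J : set A) : set A :=
  ideal_gen [set h | exists a b, [/\ I a, J b & h = a * b]].

Definition ideal_exp (I : set A) (m : nat) : set A :=
  iter m (ideal_mul I) setT.

End Ideals.

Section PowerSeriesRings.
Variables (K : fieldType) (A : comAlgType K).

Definition max_ideal (n : nat) (x : 'I_n -> A) : set A := ideal_gen (range x).

Definition right_equiv (n : nat) (x : 'I_n -> A) (f g : A) : Prop :=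
  exists phi : {lrmorphism A -> A},
    [/\ bijective phi, phi @` max_ideal x `<=` max_ideal x & phi f = g].

Definition diag_form (k n : nat) (hk : (k <= n)%N) (x : 'I_n -> A)
    (a : 'I_k -> K) : A :=
  \sum_(i < k) a i *: x (widen_ord hk i) ^+ 2.

(** [dim_K (A / I) = d]: the quotient has a [K]-basis with [d] elements, the
    classes of the [e i]. *)
Definition quotient_dim (I : set A) (d : nat) : Prop :=
  exists e : 'I_d -> A, forall h : A,
    exists! c : {ffun 'I_d -> K}, I (h - \sum_(i < d) c i *: e i).

End PowerSeriesRings.

Section Milnor.
Variables (R : realType) (K : fieldType) (v : realValuation R K) (n : nat).

Definition milnor_number (f : cps v n) (mu : nat) : Prop :=
  quotient_dim (ideal_gen (range (fun i => cderiv i f))) mu.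

Definition isolated_singularity (f : cps v n) : Prop :=
  exists mu, milnor_number f mu.

End Milnor.

(* Main.v *)
Require Import Defs.
From HB Require Import structures.
From mathcomp Require Import all_boot all_order all_algebra.
From mathcomp Require Import boolp classical_sets reals.

Set Implicit Arguments.
Unset Strict Implicit.
Unset Printing Implicit Defensive.

Import Order.TTheory GRing.Theory Num.Theory.
(* After the polynomial library, whose [coefD], [coefM], etc. would otherwise
   hide the statements on power series. *)
Import Defs.

Local Open Scope ring_scope.

(** Everything rests on an absorption principle, [absorb]: a series [f] of order
    at least two is right equivalent to
    [f + sum_lq d_lq (df/dx_l) (df/dx_q)] as soon as the [d_lq] vanish at the
    origin or [f] has order at least three. Indeed, by Taylor's formula with
    second-order remainder [R], the substitution
    [x_l |-> x_l + sum_q b_lq df/dx_q] carries [f] to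
    [f + sum_lq (b + b^T R b)_lq (df/dx_l) (df/dx_q)], and the equation
    [b + b^T R b = d] for the matrix [b] is solved by the implicit function
    theorem.

    Uniqueness of the residual part, [residual_unique]. Let [phi] carry
    [q + g0] to [q' + g1], where [q] and [q'] are nondegenerate diagonal forms
    in the first [k] variables. Restricting to the subspace on which these
    variables vanish gives [sum a_j sigma_j^2 + g0(chi) = g1], where [sigma] and
    [chi] are the components of the restriction of [phi], and [chi] is a
    coordinate change because the Hessians force the linear part of [phi] to be
    block triangular. Differentiating with respect to the first [k] variables
    before restricting shows that the [sigma_j] lie in the ideal generated by
    the [(dg0/dx_l)(chi)]. Hence [g1] is, up to the coordinate change [chi], the
    sum of [g0] and a quadratic expression in its derivatives, which is absorbed.

    Existence of the normal form, [normal_form]. A linear change diagonalizes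
    the Hessian. The implicit function theorem yields the graph of the critical
    points in the directions of the first [k] variables; after translating it to
    the subspace where they vanish, and with [g] the restriction to that
    subspace, the difference between [f] and [q + g] is
    [sum e_ij x_i x_j] with [e_ij] in the maximal ideal. Since [x_i] is, up to a
    constant, the derivative of [q + g] with respect to [x_i], this is absorbed.

    The field is not assumed complete, so the implicit function, [fixed_point],
    is constructed coefficient by coefficient as the limit of an iteration in
    the adic topology; a bound of all iterates on a common polydisc passes to
    the limit and gives convergence. Formal power series are the convergent
    series of the trivial valuation, and [right_equivP] identifies abstract local
    automorphisms with substitutions, so that all statements are treated
    together. *)

(** * Degrees, orders and monomials *)

Section Degree.
Variable n : nat.
Implicit Types a b : midx n.

Definition mdeg a : nat := (\sum_i a i)%N.

Lemma mdegD a b : mdeg (a + b) = (mdeg a + mdeg b)%N.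
Proof. by rewrite /mdeg -big_split; apply: eq_bigr => i _; rewrite maddE. Qed.

Lemma mdeg_eq0 a : (mdeg a == 0%N) = (a == 0).
Proof.
rewrite /mdeg sum_nat_eq0; apply/forallP/eqP => [a0|-> i]; last by rewrite ffunE.
by apply/ffunP => i; rewrite ffunE; apply/eqP; have := a0 i.
Qed.

Lemma mdeg0 : mdeg 0 = 0%N. Proof. exact/eqP/(etrans (mdeg_eq0 0))/eqxx. Qed.

Lemma mdeg_munit i : mdeg (munit i) = 1%N.
Proof.
rewrite /mdeg (bigD1 i) //= ffunE eqxx big1 // => j /negPf ji.
by rewrite ffunE ji.
Qed.

Lemma munit_neq0 i : munit i != 0 :> midx n.
Proof. by rewrite -mdeg_eq0 mdeg_munit. Qed.

Lemma munit_inj : injective (@munit n).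
Proof.
by move=> i j /ffunP/(_ i); rewrite !ffunE eqxx; case: eqP.
Qed.

Lemma munit_split a i : (0 < a i)%N -> exists b, a = b + munit i.
Proof.
move=> a0; exists [ffun j => (a j - (j == i))%N]; apply/ffunP => j.
by rewrite maddE !ffunE subnK //; case: eqP => // ->.
Qed.

Lemma mdeg_gt0 a : (0 < mdeg a)%N -> exists i, (0 < a i)%N.
Proof.
rewrite lt0n mdeg_eq0 => /eqP ane.
case: (pickP (fun i => 0 < a i)%N) => [i ai|a0]; first by exists i.
by case: ane; apply/ffunP => i; rewrite ffunE; have := a0 i; case: (a i).
Qed.

Lemma mdeg1P a : mdeg a = 1%N -> exists i, a = munit i.
Proof.
move=> a1; have [|i ai] := @mdeg_gt0 a; first by rewrite a1.
have [b ab] := munit_split ai; exists i; move: a1.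
by rewrite ab mdegD mdeg_munit addn1 => -[] /eqP; rewrite mdeg_eq0 => /eqP ->; rewrite add0r.
Qed.

Lemma mdeg2P a : mdeg a = 2%N -> exists i j, a = munit i + munit j.
Proof.
move=> a1; have [|i ai] := @mdeg_gt0 a; first by rewrite a1.
have [b ab] := munit_split ai; move: a1.
rewrite ab mdegD mdeg_munit addn1 => -[] /mdeg1P[j ->].
by exists j, i.
Qed.

Definition degle N : seq (midx n) :=
  [seq a <- [seq [ffun i => b i : nat] | b : {ffun 'I_n -> 'I_N.+1}] | (mdeg a <= N)%N].

Lemma mem_degle N a : (a \in degle N) = (mdeg a <= N)%N.
Proof.
rewrite mem_filter; case: leqP => //= aN; apply/fintype.imageP.
have le i : (a i < N.+1)%N.
  by rewrite ltnS (leq_trans _ aN) // /mdeg (bigD1 i) //= leq_addr.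
exists [ffun i => Ordinal (le i)] => //.
by apply/ffunP => i; rewrite !ffunE.
Qed.

Lemma uniq_degle N : uniq (degle N).
Proof.
rewrite filter_uniq // /image_mem map_inj_uniq ?enum_uniq // => b c /ffunP bc.
by apply/ffunP => i; apply/val_inj; have := bc i; rewrite !ffunE.
Qed.

End Degree.

Section Order.
Variables (K : fieldType) (n : nat).
Implicit Types (f g : fps K n) (a b : midx n).

Definition ordge N f := forall a, (mdeg a < N)%N -> coef f a = 0.

Lemma ordge0 f : ordge 0 f. Proof. by []. Qed.

Lemma ordge_le M N f : (M <= N)%N -> ordge N f -> ordge M f.
Proof. by move=> MN Nf a aM; apply: Nf; apply: leq_trans MN. Qed.

Lemma ordgeD N f g : ordge N f -> ordge N g -> ordge N (f + g).
Proof. by move=> Nf Ng a aN; rewrite coefD Nf ?Ng ?addr0. Qed.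

Lemma ordgeN N f : ordge N f -> ordge N (- f).
Proof. by move=> Nf a aN; rewrite coefN Nf ?oppr0. Qed.

Lemma ordgeB N f g : ordge N f -> ordge N g -> ordge N (f - g).
Proof. by move=> Nf Ng; apply: ordgeD => //; apply: ordgeN. Qed.

Lemma ordgeZ N c f : ordge N f -> ordge N (c *: f).
Proof. by move=> Nf a aN; rewrite coefZ Nf ?mulr0. Qed.

Lemma ordge_sum N (I : Type) (s : seq I) (P : pred I) (F : I -> fps K n) :
  (forall i, P i -> ordge N (F i)) -> ordge N (\sum_(i <- s | P i) F i).
Proof.
by move=> NF; apply: big_ind => //; exact: ordgeD.
Qed.

Lemma ordgeM M N f g : ordge M f -> ordge N g -> ordge (M + N) (f * g).
Proof.
move=> Mf Ng a aMN; rewrite coefM big_seq big1 // => -[b c] /=.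
rewrite mem_splits => /eqP /= bc; move: aMN; rewrite -bc mdegD => lt.
have [bM|Mb] := ltnP (mdeg b) M; first by rewrite Mf ?mul0r.
rewrite Ng ?mulr0 // ltnNge; apply/negP => Nc.
by move: lt; rewrite ltnNge leq_add.
Qed.

Lemma ordgeMl N f g : ordge N g -> ordge N (f * g).
Proof. exact: (@ordgeM 0 N). Qed.

Lemma ordgeX N f m : ordge N f -> ordge (N * m) (f ^+ m).
Proof.
move=> Nf; elim: m => [|m IH]; first by rewrite muln0.
by rewrite exprS mulnS; apply: ordgeM.
Qed.

Lemma ordge_eq0 f : (forall N, ordge N f) -> f = 0.
Proof. by move=> h; apply/fpsP => a; rewrite (h (mdeg a).+1) ?coef0. Qed.

Lemma ordge1P f : ordge 1 f <-> coef f 0 = 0.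
Proof.
split=> [h|h a]; first by rewrite h ?mdeg0.
by rewrite ltnS leqn0 mdeg_eq0 => /eqP ->.
Qed.

Lemma coef0M f g : coef (f * g) 0 = coef f 0 * coef g 0.
Proof.
rewrite coefM (bigD1_seq (0, 0)) ?uniq_splits ?mem_splits /= ?addr0 //.
rewrite big_seq_cond big1 ?addr0 // => -[b c]; rewrite mem_splits /= => /andP[].
rewrite -mdeg_eq0 mdegD addn_eq0 !mdeg_eq0 => /andP[/eqP -> /eqP ->].
by rewrite eqxx.
Qed.

Lemma coef_sum (I : Type) (s : seq I) (P : pred I) (F : I -> fps K n) a :
  coef (\sum_(i <- s | P i) F i) a = \sum_(i <- s | P i) coef (F i) a.
Proof. by apply: (big_morph (fun h => coef h a) (fun f g => coefD f g a) (coef0 K a)). Qed.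

Lemma coef1M f g i :
  coef (f * g) (munit i)
  = coef f (munit i) * coef g 0 + coef f 0 * coef g (munit i).
Proof.
have ne : (munit i, 0) != (0, munit i) :> midx n * midx n.
  by rewrite xpair_eqE (negPf (munit_neq0 i)).
have e : perm_eq (splits (munit i)) [:: (munit i, 0); (0, munit i)].
  apply: uniq_perm; rewrite ?uniq_splits //= ?inE ?ne // => -[b c].
  rewrite mem_splits !inE; apply/eqP/orP => /= [bc|]; last first.
    by case=> /eqP [-> ->]; rewrite ?addr0 ?add0r.
  have : mdeg (b + c) = 1%N by rewrite bc mdeg_munit.
  rewrite mdegD; case: (mdeg b) (mdeg_eq0 b) => [/esym/eqP b0 _|d _].
    by right; rewrite -bc b0 add0r.
  rewrite addSn => -[] /eqP; rewrite addn_eq0 (mdeg_eq0 c) => /andP[_ /eqP c0].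
  by left; rewrite -bc c0 addr0.
by rewrite coefM (perm_big _ e) !big_cons big_nil /= addr0.
Qed.

End Order.

Section Monomial.
Variables (K : fieldType) (n : nat).
Implicit Types (a b : midx n).

Definition mono b : fps K n := Fps (fun a => (a == b)%:R).

Lemma mono0 : mono 0 = 1. Proof. by apply/fpsP => a; rewrite coef1. Qed.

Lemma coef_monoM b (f : fps K n) a : coef (mono b * f) (b + a) = coef f a.
Proof.
rewrite coefM (bigD1_seq (b, a)) ?uniq_splits ?mem_splits //= eqxx mul1r.
rewrite big_seq_cond big1 ?addr0 // => -[c d]; rewrite mem_splits /=.
move=> /andP[/eqP cd ne]; case: eqP => [cb|_]; last by rewrite mul0r.
by move: cd ne; rewrite cb => /maddI ->; rewrite eqxx.
Qed.

Lemma coef_monoM0 b (f : fps K n) a :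
  (forall c, a <> b + c) -> coef (mono b * f) a = 0.
Proof.
move=> ne; rewrite coefM big_seq big1 // => -[c d]; rewrite mem_splits /=.
by move=> /eqP cd; case: eqP => [cb|_]; [case: (ne d); rewrite -cb | rewrite mul0r].
Qed.

Lemma monoM a b : mono a * mono b = mono (a + b).
Proof.
apply/fpsP => c; have [[d ->]|nd] := pselect (exists d, c = a + d).
  by rewrite coef_monoM /= (inj_eq (@maddI _ a)).
rewrite coef_monoM0 => [/=|d cd]; last by apply: nd; exists d.
by case: eqP => // cab; case: nd; exists b.
Qed.

Lemma monoX a m : mono a ^+ m = mono (a *+ m).
Proof.
by elim: m => [|m IH]; rewrite ?expr0 ?mulr0n ?mono0 // exprS IH monoM -mulrS.
Qed.

Lemma ordge_fvar i : ordge 1 (fvar i : fps K n).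
Proof. by apply/ordge1P => /=; rewrite eq_sym (negPf (munit_neq0 i)). Qed.

Lemma coef1_fvar i j : coef (fvar i : fps K n) (munit j) = (j == i)%:R.
Proof. by rewrite /= (inj_eq (@munit_inj n)). Qed.

End Monomial.

(** * Substitution *)

Lemma sum_uniq_subset (V : nmodType) (T : eqType) (s t : seq T) (F : T -> V) :
  uniq s -> uniq t -> {subset s <= t} -> (forall i, i \in t -> i \notin s -> F i = 0) ->
  \sum_(i <- t) F i = \sum_(i <- s) F i.
Proof.
move=> us ut st F0; rewrite (bigID (mem s)) /= [X in _ + X]big_seq_cond.
rewrite [X in _ + X]big1 ?addr0 => [|i /andP[it nis]]; last exact: F0.
rewrite -big_filter; apply: perm_big; apply: uniq_perm; rewrite ?filter_uniq //.
by move=> i; rewrite mem_filter; case: (boolP (i \in s)) => //= /st ->.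
Qed.

Section Substitution.
Variables (K : fieldType) (m n : nat).
Implicit Types (g : 'I_m -> fps K n) (f : fps K m) (a : midx n) (b : midx m).

Definition pw g b : fps K n := \prod_i g i ^+ b i.

Lemma pw0 g : pw g 0 = 1.
Proof. by apply: big1 => i _; rewrite ffunE. Qed.

Lemma pwD g b c : pw g (b + c) = pw g b * pw g c.
Proof. by rewrite /pw -big_split; apply: eq_bigr => i _; rewrite maddE exprD. Qed.

Lemma pw_munit g i : pw g (munit i) = g i.
Proof.
rewrite /pw (bigD1 i) //= big1 => [|j /negPf ji]; first by rewrite ffunE eqxx mulr1.
by rewrite ffunE ji.
Qed.

Lemma ordge_pw g b : (forall i, ordge 1 (g i)) -> ordge (mdeg b) (pw g b).
Proof.
move=> g1; rewrite /pw /mdeg; elim/big_ind2: _ => [||i _].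
- exact: ordge0.
- by move=> ? ? ? ? h1 h2; apply: ordgeM.
- by have := @ordgeX _ _ 1 (g i) (b i) (g1 i); rewrite mul1n.
Qed.

Definition mpart (u : fps K n) : fps K n := u - (coef u 0)%:A.

Lemma ordge_mpart u : ordge 1 (mpart u).
Proof. by apply/ordge1P; rewrite /mpart coefD coefN coefZ coef1 eqxx mulr1 subrr. Qed.

Lemma mpart_id u : ordge 1 u -> mpart u = u.
Proof. by move=> /ordge1P f0; rewrite /mpart f0 scale0r subr0. Qed.

(** The constant terms of the [g i] are removed, so that substitution is a
    homomorphism for every [g]. *)
Definition subst g f : fps K n :=
  Fps (fun a => \sum_(b <- degle m (mdeg a)) coef f b * coef (pw (mpart \o g) b) a).

Arguments subst : simpl never.

(** Powers of [g] of degree larger than [N] do not reach the coefficient of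
    [x^a], so the sum may be extended at will. *)
Lemma substE g f a N : (mdeg a <= N)%N ->
  coef (subst g f) a = \sum_(b <- degle m N) coef f b * coef (pw (mpart \o g) b) a.
Proof.
move=> aN; apply/esym/sum_uniq_subset; rewrite ?uniq_degle // => b.
  by rewrite !mem_degle => h; apply: leq_trans aN.
rewrite !mem_degle -ltnNge => _ lt; rewrite (@ordge_pw _ b) ?mulr0 // => i.
exact: ordge_mpart.
Qed.

Lemma subst_is_linear g : linear (subst g).
Proof.
move=> c f h; apply/fpsP => a.
rewrite coefD coefZ !(substE _ _ (leqnn _)) mulr_sumr -big_split /=.
by apply: eq_bigr => b _; rewrite mulrDl mulrA.
Qed.

Lemma subst1 g : subst g 1 = 1.
Proof.
apply/fpsP => a; rewrite (substE _ _ (leqnn _)).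
rewrite (bigD1_seq 0) ?uniq_degle ?mem_degle ?mdeg0 //=.
by rewrite eqxx mul1r pw0 big1 ?addr0 // => b /negPf ->; rewrite mul0r.
Qed.

(** Both sides sum [f_b h_c g^(b + c)] over pairs of multi-indices: on the left
    over those of total degree at most [N], on the right over a square, whose
    further pairs contribute nothing. *)
Lemma substM g f h : subst g (f * h) = subst g f * subst g h.
Proof.
apply/fpsP => a; set N := mdeg a; set s := degle m N; set G := mpart \o g.
pose T (p : midx m * midx m) := coef f p.1 * coef h p.2 * coef (pw G (p.1 + p.2)) a.
transitivity (\sum_(p <- [seq (b, c) | b <- s, c <- s]) T p); last first.
  rewrite coefM; transitivity (\sum_(q <- splits a) \sum_(b <- s) \sum_(c <- s)
     (coef f b * coef h c) * (coef (pw G b) q.1 * coef (pw G c) q.2)).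
    rewrite big_allpairs_dep /=.
    rewrite [RHS]exchange_big; apply: eq_bigr => b _ /=.
    rewrite [RHS]exchange_big; apply: eq_bigr => c _ /=.
    by rewrite /T /= pwD coefM mulr_sumr.
  rewrite big_seq [RHS]big_seq; apply: eq_bigr => -[q r]; rewrite mem_splits => /eqP qr; rewrite [in RHS]/fst [in RHS]/snd.
  have le1 : (mdeg q <= N)%N by rewrite /N -qr mdegD leq_addr.
  have le2 : (mdeg r <= N)%N by rewrite /N -qr mdegD leq_addl.
  rewrite (substE _ _ le1) (substE _ _ le2) mulr_suml; apply: eq_bigr => b _.
  by rewrite mulr_sumr; apply: eq_bigr => c _; rewrite mulrACA.
rewrite (@substE _ _ _ N) //.
pose L := [seq p | b <- s, p <- splits b].
transitivity (\sum_(p <- L) T p).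
  rewrite big_allpairs_dep; apply: eq_bigr => b _; rewrite coefM mulr_suml.
  rewrite big_seq [RHS]big_seq; apply: eq_bigr => -[c d]; rewrite mem_splits /= => /eqP cd.
  by rewrite /T /= cd.
apply/esym/sum_uniq_subset.
- apply: allpairs_uniq_dep; [exact: uniq_degle | by move=> p _; apply: uniq_splits |].
  move=> _ _ /allpairsPdep[p [q [_ + ->]]] /allpairsPdep[p' [q' [_ + ->]]] /=.
  by rewrite !mem_splits => /eqP <- /eqP <- ->.
- by apply: allpairs_uniq; [exact: uniq_degle | exact: uniq_degle | move=> -[? ?] [? ?]].
- move=> _ /allpairsPdep[p [q [+ + ->]]]; rewrite mem_splits mem_degle => le /eqP pq.
  rewrite -pq mdegD in le; apply/allpairsP; exists q; rewrite !mem_degle; split.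
  + exact: leq_trans (leq_addr _ _) le.
  + exact: leq_trans (leq_addl _ _) le.
  + by case: (q).
move=> [b c] _ nL; rewrite /T /= (@ordge_pw _ (b + c)) ?mulr0 // => [i|].
  exact: ordge_mpart.
rewrite ltnNge; apply: contra nL => le; apply/allpairsPdep.
by exists (b + c), (b, c); rewrite mem_degle mem_splits /=.
Qed.

HB.instance Definition _ g :=
  GRing.isLinear.Build K (fps K m) (fps K n) *:%R (subst g) (subst_is_linear g).
HB.instance Definition _ g :=
  GRing.isMonoidMorphism.Build (fps K m) (fps K n) (subst g)
    (conj (subst1 g) (substM g)).

Lemma substD g f h : subst g (f + h) = subst g f + subst g h.
Proof. exact: raddfD. Qed.

Lemma substB g f h : subst g (f - h) = subst g f - subst g h.
Proof. exact: raddfB. Qed.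

Lemma subst0 g : subst g 0 = 0. Proof. exact: raddf0. Qed.

Lemma substZ g c f : subst g (c *: f) = c *: subst g f.
Proof. exact: linearZZ. Qed.

Lemma subst_sum g (I : Type) (s : seq I) (P : pred I) (F : I -> fps K m) :
  subst g (\sum_(i <- s | P i) F i) = \sum_(i <- s | P i) subst g (F i).
Proof. exact: raddf_sum. Qed.

Lemma substX g f k : subst g (f ^+ k) = subst g f ^+ k.
Proof. exact: rmorphXn. Qed.

Lemma subst_fvar g i : ordge 1 (g i) -> subst g (fvar i) = g i.
Proof.
move=> gi; apply/fpsP => a; rewrite (@substE _ _ _ (mdeg a).+1) //=.
rewrite (bigD1_seq (munit i)) ?uniq_degle ?mem_degle ?mdeg_munit //=.
rewrite eqxx mul1r pw_munit /comp mpart_id // big1 ?addr0 // => b /negPf ->.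
by rewrite mul0r.
Qed.

Lemma ordge_subst g f N : ordge N f -> ordge N (subst g f).
Proof.
move=> Nf a aN; rewrite (substE _ _ (leqnn _)) big_seq big1 // => b; rewrite mem_degle => le.
by rewrite Nf ?mul0r // (leq_ltn_trans le).
Qed.

End Substitution.

(** * Division by variables *)

Section Division.
Variables (K : fieldType) (n : nat) (S : pred 'I_n).
Implicit Types (f : fps K n) (a : midx n).

Definition first_var a i :=
  [&& S i, (0 < a i)%N & [forall j, (S j && (0 < a j)%N) ==> (i <= j)%N]].

(** Each monomial involving a variable of [S] is divided by the first such
    variable, so that no monomial is counted twice in [divided_sum]. *)
Definition divided i f : fps K n :=
  Fps (fun b => if first_var (b + munit i) i then coef f (b + munit i) else 0).

Lemma divided_sum f a :
  coef (\sum_(i | S i) fvar i * divided i f) a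
  = if [exists i, S i && (0 < a i)%N] then coef f a else 0.
Proof.
have ai i (b : midx n) : (0 < (b + munit i)%R i)%N by rewrite maddE ffunE eqxx addn1.
have term i : S i -> coef (fvar i * divided i f) a
    = if first_var a i then coef f a else 0.
  move=> Si; have [a0|/munit_split[b ->]] := posnP (a i).
    rewrite coef_monoM0 => [|c ac]; first by rewrite /first_var a0 andbF.
    by have := ai i c; rewrite addrC -ac a0.
  by rewrite [X in coef _ X]addrC coef_monoM.
rewrite coef_sum (eq_bigr _ term); case: ifP => [/existsP[i Pi]|/negbT].
  have [j] := @arg_minnP _ i (fun i => S i && (0 < a i)%N) (fun i : 'I_n => i : nat) Pi.
  move=> /andP[Sj aj] jmin.
  have fj : first_var a j.
    by rewrite /first_var Sj aj; apply/forallP => l; apply/implyP => /jmin.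
  rewrite (bigD1 j) //= fj big1 ?addr0 // => l /andP[Sl lj].
  case: ifP => // /and3P[_ al /forallP lmin]; case/eqP: lj; apply/val_inj/eqP.
  rewrite eqn_leq jmin ?Sl // andbT.
  by have := lmin j; rewrite Sj aj.
rewrite negb_exists => /forallP na; apply: big1 => i Si.
by rewrite /first_var; have := na i; rewrite Si /= => /negPf ->.
Qed.

Lemma ordge_divided N i f : ordge N.+1 f -> ordge N (divided i f).
Proof. by move=> Nf a aN /=; case: ifP => // _; rewrite Nf // mdegD mdeg_munit addn1. Qed.

End Division.

Section Hadamard.
Variables (K : fieldType) (n : nat).

Lemma hadamard (f : fps K n) :
  f = (coef f 0)%:A + \sum_i fvar i * divided predT i f.
Proof.
apply/fpsP => a; rewrite coefD coefZ coef1 (divided_sum predT).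
have [->|a0] := eqVneq a 0.
  by rewrite mulr1; case: existsP => [[i]|]; rewrite ?addr0 // ffunE.
rewrite mulr0 add0r; case: existsP => // -[].
by apply/mdeg_gt0; rewrite lt0n mdeg_eq0.
Qed.

End Hadamard.

(** Substitutions are determined by the images of the variables: the difference
    of two homomorphisms agreeing on the variables gains one order at each
    application of [f = c + sum x_i q_i]. *)
Lemma local_hom_eq (K : fieldType) (A : comAlgType K) (n m : nat) (x : 'I_n -> A)
    (had : forall f : A, exists c q, f = c%:A + \sum_i x i * q i)
    (phi psi : {lrmorphism A -> fps K m}) :
  (forall i, phi (x i) = psi (x i)) -> (forall i, ordge 1 (phi (x i))) -> phi =1 psi.
Proof.
move=> eqx x1 f; apply/eqP; rewrite -subr_eq0; apply/eqP/ordge_eq0 => N.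
elim: N f => [|N IH] f; first exact: ordge0.
have [c [q ->]] := had f.
rewrite !rmorphD /= !linearZZ !rmorph1 opprD addrACA subrr add0r !rmorph_sum -sumrB.
apply: ordge_sum => i _; rewrite !rmorphM /= -eqx -mulrBr.
exact: (@ordgeM _ _ 1).
Qed.

Section SubstTheory.
Variable (K : fieldType).

Lemma had_fps n (f : fps K n) : exists c q, f = c%:A + \sum_i fvar i * q i.
Proof. by exists (coef f 0), (fun i => divided predT i f); apply: hadamard. Qed.

Lemma subst_comp m n p (g : 'I_m -> fps K n) (h : 'I_n -> fps K p) (f : fps K m) :
  (forall i, ordge 1 (g i)) ->
  subst h (subst g f) = subst (fun i => subst h (g i)) f.
Proof.
move=> g1; apply: (local_hom_eq (@had_fps m) (phi := subst h \o subst g)) => i /=.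
  by rewrite !subst_fvar //; apply: ordge_subst.
by rewrite subst_fvar //; apply: ordge_subst.
Qed.

Lemma subst_id n (f : fps K n) : subst fvar f = f.
Proof.
apply: (local_hom_eq (@had_fps n) (psi := idfun)) => i /=.
  by rewrite subst_fvar //; apply: ordge_fvar.
by apply: ordge_subst; apply: ordge_fvar.
Qed.

Lemma eq_subst m n (g h : 'I_m -> fps K n) (f : fps K m) :
  g =1 h -> subst g f = subst h f.
Proof. by move=> /funext ->. Qed.

Lemma coef0_subst m n (g : 'I_m -> fps K n) (f : fps K m) :
  coef (subst g f) 0 = coef f 0.
Proof.
have e1 : coef (subst g (mpart f)) 0 = 0 by apply/ordge1P/ordge_subst/ordge_mpart.
transitivity (coef (subst g (mpart f + (coef f 0)%:A)) 0); first by rewrite /mpart subrK.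
by rewrite substD substZ subst1 coefD e1 add0r coefZ coef1 eqxx mulr1.
Qed.

Lemma coef1_divided n (f : fps K n) l : coef (divided predT l f) 0 = coef f (munit l).
Proof.
rewrite /= add0r; case: ifP => // /negP[]; rewrite /first_var /= ffunE eqxx /=.
by apply/forallP => j; rewrite ffunE; apply/implyP; case: eqP => // ->.
Qed.

Lemma coef1_subst m n (g : 'I_m -> fps K n) (f : fps K m) j :
  (forall l, ordge 1 (g l)) ->
  coef (subst g f) (munit j) = \sum_l coef f (munit l) * coef (g l) (munit j).
Proof.
move=> g1; rewrite {1}(hadamard f) substD substZ subst1 subst_sum coefD.
rewrite coefZ coef1 (negPf (munit_neq0 j)) mulr0 add0r coef_sum.
apply: eq_bigr => l _; rewrite substM subst_fvar // coef1M coef0_subst.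
by rewrite coef1_divided (ordge1P (g l)).1 // mul0r addr0 mulrC.
Qed.

Definition jac m n (g : 'I_m -> fps K n) : 'M[K]_(m, n) :=
  \matrix_(l, j) coef (g l) (munit j).

Lemma jac_subst m n p (g : 'I_m -> fps K n) (h : 'I_n -> fps K p) :
  (forall i, ordge 1 (h i)) -> jac (fun i => subst h (g i)) = jac g *m jac h.
Proof.
move=> h1; apply/matrixP => i j; rewrite !mxE coef1_subst //.
by apply: eq_bigr => l _; rewrite !mxE.
Qed.

Lemma jac_fvar n : jac (fvar : 'I_n -> fps K n) = 1%:M.
Proof. by apply/matrixP => i j; rewrite !mxE coef1_fvar eq_sym. Qed.

End SubstTheory.

(** * Series in part of the variables *)

Section Embedding.
Variables (K : fieldType) (m n : nat) (e : 'I_n -> 'I_m).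
Hypothesis e_inj : injective e.
Implicit Types (f : fps K m) (g : fps K n).

(** The exponent of the image of [x^b] under [x_j |-> x_(e j)]. *)
Definition push (b : midx n) : midx m := \sum_j munit (e j) *+ b j.

Definition off : pred 'I_m := fun i => i \notin codom e.

Lemma sum_midx (I : Type) (s : seq I) (P : pred I) (F : I -> midx m) i :
  (\sum_(j <- s | P j) F j) i = (\sum_(j <- s | P j) F j i)%N.
Proof. by elim/big_rec2: _ => [|j x y _ <-]; rewrite ?ffunE ?maddE. Qed.

Lemma midxMn p (a : midx p) k i : (a *+ k) i = (a i * k)%N.
Proof. by elim: k => [|k IH]; rewrite ?muln0 ?mulr0n ?ffunE // mulrS maddE IH mulnS. Qed.

Lemma push_e b j : push b (e j) = b j.
Proof.
rewrite /push sum_midx (bigD1 j) //= midxMn ffunE eqxx mul1n big1 ?addn0 // => l lj.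
by rewrite midxMn ffunE (inj_eq e_inj) eq_sym (negPf lj).
Qed.

Lemma push_off b i : off i -> push b i = 0%N.
Proof.
move=> ei; rewrite /push sum_midx big1 // => j _; rewrite midxMn ffunE.
by case: eqP => // ij; move: ei; rewrite /off ij codom_f.
Qed.

Lemma pushP (a : midx m) : (forall i, off i -> a i = 0%N) ->
  a = push [ffun j => a (e j)].
Proof.
move=> a0; apply/ffunP => i; have [/codomP[j ->]|ni] := boolP (i \in codom e).
  by rewrite push_e ffunE.
by rewrite push_off // a0.
Qed.

Definition keep f : fps K n := Fps (fun b => coef f (push b)).

Lemma mono_prod (F : 'I_n -> midx m) :
  \prod_j mono K (F j) = mono K (\sum_j F j).
Proof. by elim/big_rec2: _ => [|j x y _ ->]; rewrite ?mono0 ?monoM. Qed.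

Lemma coef_embed g a :
  coef (subst (fvar \o e) g) a
  = if [exists i, off i && (0 < a i)%N] then 0 else coef g [ffun j => a (e j)].
Proof.
have pwE b : pw (@mpart K m \o (fvar \o e)) b = mono K (push b).
  rewrite /push -mono_prod; apply: eq_bigr => j _.
  by rewrite /= mpart_id ?monoX //; apply: ordge_fvar.
set b := [ffun j => _].
rewrite (substE _ _ (leq_addr (mdeg b) _)); case: ifP => [/existsP[i /andP[oi ai]]|/negbT].
  rewrite big1 // => c _; rewrite pwE /=; case: eqP => [ab|]; last by rewrite mulr0.
  by move: ai; rewrite ab push_off.
rewrite negb_exists => /forallP h.
have ab : a = push b.
  by apply: pushP => i oi; have := h i; rewrite oi lt0n negbK => /eqP.
rewrite (bigD1_seq b) ?uniq_degle //=; last first.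
  by rewrite mem_degle leq_addl.
rewrite pwE /= -ab eqxx mulr1 big1 ?addr0 // => c cb.
rewrite pwE /=; case: eqP => [ac|]; last by rewrite mulr0.
by case/eqP: cb; apply/ffunP => j; rewrite ffunE ac push_e.
Qed.

(** A monomial either involves only variables in the image of [e], or is
    divisible by one of the others. *)
Lemma embed_split f :
  f = subst (fvar \o e) (keep f) + \sum_(i | off i) fvar i * divided off i f.
Proof.
apply/fpsP => a; rewrite coefD coef_embed divided_sum.
case: ifP => [|/negbT]; rewrite ?add0r ?addr0 //.
rewrite negb_exists => /forallP h /=; congr coef; apply: pushP => i oi.
by have := h i; rewrite oi lt0n negbK => /eqP.
Qed.

End Embedding.

(** * Convergence *)

Section Bounds.
Variables (R : realType) (K : fieldType) (v : realValuation R K).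

Lemma ler_sum_subset (T : eqType) (s t : seq T) (F : T -> R) :
  uniq s -> uniq t -> {subset s <= t} -> (forall i, 0 <= F i) ->
  \sum_(i <- s) F i <= \sum_(i <- t) F i.
Proof.
move=> us ut st F0; rewrite [leRHS](bigID (mem s)) /= -[leLHS]addr0.
apply: lerD; last exact: sumr_ge0.
rewrite -[leRHS]big_filter le_eqVlt; apply/orP; left; apply/eqP/perm_big.
apply: uniq_perm; rewrite ?filter_uniq // => i; rewrite mem_filter.
by case: (boolP (i \in s)) => //= /st ->.
Qed.

Section OneRing.
Variable n : nat.
Implicit Types (f g : fps K n) (eps : 'I_n -> R) (a : midx n).

Lemma mon_const (r : R) a : mon (fun=> r) a = r ^+ mdeg a.
Proof. by rewrite /mon /mdeg expr_sum. Qed.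

Lemma bounded_at_bound f eps M N : M <= N -> bounded_at v f eps M -> bounded_at v f eps N.
Proof. by move=> MN bf s us; apply: le_trans (bf s us) MN. Qed.

Lemma bounded_at1 eps : bounded_at v (1 : fps K n) eps 1.
Proof.
move=> s us; have t0 a : a != 0 -> v (coef (1 : fps K n) a) * mon eps a = 0.
  by move=> /negPf a0; rewrite coef1 a0 rval0 mul0r.
have [s0|s0] := boolP (0 \in s).
  rewrite (bigD1_seq 0) //= eqxx rval1 mul1r big1 ?addr0 => [|a /t0 //].
  by rewrite /mon big1 // => i _; rewrite ffunE.
by rewrite big_seq big1 // => a as_; rewrite t0 //; apply: contraNneq s0 => <-.
Qed.

(** Every finite set of pairs of multi-indices lies in a product of two finite
    sets, where the sum of the products factors. *)
Lemma bounded_atM f g eps M N : (forall i, 0 < eps i) ->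
  bounded_at v f eps M -> bounded_at v g eps N -> bounded_at v (f * g) eps (M * N).
Proof.
move=> e0 bf bg s us.
pose F a := v (coef f a) * mon eps a; pose G a := v (coef g a) * mon eps a.
have F0 a : 0 <= F a by rewrite mulr_ge0 ?rval_ge0 ?mon_ge0.
have G0 a : 0 <= G a by rewrite mulr_ge0 ?rval_ge0 ?mon_ge0.
pose L := [seq p | a <- s, p <- splits a].
pose B := undup [seq p.1 | p <- L]; pose C := undup [seq p.2 | p <- L].
have le1 : \sum_(a <- s) v (coef (f * g) a) * mon eps a <= \sum_(p <- L) F p.1 * G p.2.
  rewrite big_allpairs_dep; apply: ler_sum => a _; rewrite coefM.
  apply: (le_trans (ler_wpM2r (mon_ge0 _ e0) (rval_sum _ _ _))).
  rewrite mulr_suml [leLHS]big_seq [leRHS]big_seq; apply: ler_sum => -[b c].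
  by rewrite mem_splits /= => /eqP <-; rewrite monD rvalM /F /G mulrACA.
apply: (le_trans le1).
apply: (@le_trans _ _ (\sum_(p <- [seq (b, c) | b <- B, c <- C]) F p.1 * G p.2)).
  apply: ler_sum_subset => [|||p]; last by rewrite mulr_ge0.
  - apply: allpairs_uniq_dep => // [p _|]; first exact: uniq_splits.
    move=> _ _ /allpairsPdep[p [q [_ + ->]]] /allpairsPdep[p' [q' [_ + ->]]] /=.
    by rewrite !mem_splits => /eqP <- /eqP <- ->.
  - by apply: allpairs_uniq; rewrite ?undup_uniq // => -[? ?] [? ?].
  move=> [b c] pL; apply/allpairsP; exists (b, c); rewrite !mem_undup; split => //.
    exact: (map_f fst pL).
  exact: (map_f snd pL).
rewrite big_allpairs_dep /= (eq_bigr (fun b => F b * \sum_(c <- C) G c)); last first.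
  by move=> b _; rewrite mulr_sumr.
rewrite -mulr_suml ler_pM ?sumr_ge0 //; first by apply: bf; rewrite undup_uniq.
by apply: bg; rewrite undup_uniq.
Qed.

Lemma bounded_at_pw m (g : 'I_m -> fps K n) eps (d : 'I_m -> R) b :
  (forall i, 0 < eps i) -> (forall i, bounded_at v (g i) eps (d i)) ->
  bounded_at v (pw g b) eps (mon d b).
Proof.
move=> e0 bg; rewrite /pw /mon; elim/big_ind2: _ => [||i _].
- exact: bounded_at1.
- by move=> ? ? ? ?; apply: bounded_atM.
elim: (b i) => [|k IH]; first by rewrite !expr0; apply: bounded_at1.
by rewrite !exprS; apply: bounded_atM.
Qed.

(** Without constant term, each term shrinks at least as fast as the radii. *)
Lemma bounded_at_shrink f eps M t : (forall i, 0 < eps i) -> 0 < t -> t <= 1 ->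
  ordge 1 f -> bounded_at v f eps M -> bounded_at v f (fun i => t * eps i) (t * M).
Proof.
move=> e0 t0 t1 f1 bf s us; apply: le_trans (ler_wpM2l (ltW t0) (bf s us)).
rewrite mulr_sumr; apply: ler_sum => a _.
have [->|a0] := eqVneq a 0; first by rewrite f1 ?mdeg0 // rval0 !mul0r mulr0.
rewrite mulrCA ler_wpM2l ?rval_ge0 //.
have -> : mon (fun i => t * eps i) a = t ^+ mdeg a * mon eps a.
  rewrite /mon /mdeg expr_sum -big_split /=; apply: eq_bigr => i _.
  exact: exprMn.
rewrite ler_wpM2r ?mon_ge0 //; case: (mdeg a) (mdeg_eq0 a) => [|k _].
  by rewrite (negPf a0).
by rewrite exprS ler_piMr ?(ltW t0) // exprn_ile1 ?(ltW t0).
Qed.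

Lemma common_radius (I : finType) (F : I -> fps K n) :
  (forall i, convergent v (F i)) ->
  exists r M, 0 < r /\ forall i, bounded_at v (F i) (fun=> r) M.
Proof.
move=> cF; suff [r [M [r0 h]]] : exists r M, 0 < r /\
    forall i, i \in enum I -> bounded_at v (F i) (fun=> r) M.
  by exists r, M; split=> // i; apply: h; rewrite mem_enum.
elim: (enum I) => [|i s [r [M [r0 h]]]]; first by exists 1, 0.
have /convergentP[eps [N [e0 bi]]] := cF i.
have [q q0 qle] : exists2 q, 0 < q & forall j, q <= eps j.
  suff [q q0 qle] : exists2 q, 0 < q & forall j, j \in enum 'I_n -> q <= eps j.
    by exists q => // j; apply: qle; rewrite mem_enum.
  elim: (enum 'I_n) => [|j u [q q0 qle]]; first by exists 1.
  exists (Num.min q (eps j)); first by rewrite lt_min q0 e0.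
  move=> l; rewrite inE ge_min => /predU1P[->|/qle ->//]; by rewrite lexx orbT.
have m0 : 0 < Num.min q r by rewrite lt_min q0 r0.
exists (Num.min q r), (Num.max N M); split=> // j; rewrite inE => /predU1P[->|/h bj].
  apply: (@bounded_at_bound _ _ N); first by rewrite le_max lexx.
  by apply: bounded_at_le bi => // l; rewrite ge_min qle.
apply: (@bounded_at_bound _ _ M); first by rewrite le_max lexx orbT.
by apply: bounded_at_le bj => // l; rewrite ge_min lexx orbT.
Qed.

Lemma convergentN f : convergent v f -> convergent v (- f).
Proof. by rewrite -scaleN1r; apply: convergentZ. Qed.

Lemma convergentB f g : convergent v f -> convergent v g -> convergent v (f - g).
Proof. by move=> cf cg; apply: convergentD => //; apply: convergentN. Qed.

Lemma convergent_sum (I : Type) (s : seq I) (P : pred I) (F : I -> fps K n) :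
  (forall i, P i -> convergent v (F i)) -> convergent v (\sum_(i <- s | P i) F i).
Proof.
by move=> cF; apply: big_ind => //; [exact: convergent0 | exact: convergentD].
Qed.

Lemma convergentX f k : convergent v f -> convergent v (f ^+ k).
Proof.
by move=> cf; elim: k => [|k IH]; [exact: convergent1 | rewrite exprS; apply: convergentM].
Qed.

Lemma convergent_divided (S : pred 'I_n) i f :
  convergent v f -> convergent v (divided S i f).
Proof.
move=> /convergentP[eps [M [e0 bf]]]; apply/convergentP.
exists eps, ((eps i)^-1 * M); split=> // s us.
have us' : uniq [seq a + munit i | a <- s].
  by rewrite map_inj_uniq // => a b; rewrite ![_ + munit i]addrC => /maddI.
apply: le_trans (ler_wpM2l _ (bf _ us')); last by rewrite invr_ge0 ltW.
rewrite big_map mulr_sumr; apply: ler_sum => a _ /=.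
have -> : mon eps (a + munit i) = eps i * mon eps a.
  rewrite monD mulrC; congr (_ * _); rewrite /mon (bigD1 i) //= ffunE eqxx.
  by rewrite big1 ?mulr1 // => j /negPf ji; rewrite ffunE ji.
rewrite [leRHS]mulrCA mulKf ?gt_eqF //; case: ifP => // _.
by rewrite rval0 mul0r mulr_ge0 ?rval_ge0 ?mon_ge0.
Qed.

End OneRing.

Section TwoRings.
Variables m n : nat.

Lemma bounded_at_subst (g : 'I_m -> fps K n) (f : fps K m) eps (d : 'I_m -> R) M :
  (forall i, ordge 1 (g i)) -> (forall i, 0 < eps i) ->
  (forall i, bounded_at v (g i) eps (d i)) -> bounded_at v f d M ->
  bounded_at v (subst g f) eps M.
Proof.
move=> g1 e0 bg bf s us; pose N := (\sum_(a <- s) mdeg a)%N.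
have gE : @mpart K n \o g = g by apply/funext => i; apply: mpart_id.
apply: le_trans (bf _ (uniq_degle m N)).
apply: (@le_trans _ _ (\sum_(a <- s) \sum_(b <- degle m N)
    v (coef f b) * (v (coef (pw g b) a) * mon eps a))).
  rewrite [leLHS]big_seq [leRHS]big_seq; apply: ler_sum => a as_.
  rewrite (@substE _ _ _ _ _ _ N); last by rewrite /N (big_rem a) //= leq_addr.
  apply: (le_trans (ler_wpM2r (mon_ge0 _ e0) (rval_sum _ _ _))).
  by rewrite mulr_suml; apply: ler_sum => b _; rewrite gE rvalM mulrA.
rewrite exchange_big /=; apply: ler_sum => b _; rewrite -mulr_sumr.
by rewrite ler_wpM2l ?rval_ge0 //; apply: bounded_at_pw.
Qed.

(** Shrinking the radii brings the bounds of the [g_i] below a radius on which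
    [f] is bounded. *)
Lemma convergent_subst (g : 'I_m -> fps K n) (f : fps K m) :
  (forall i, ordge 1 (g i)) -> (forall i, convergent v (g i)) ->
  convergent v f -> convergent v (subst g f).
Proof.
move=> g1 /common_radius[r [N [r0 bg]]] cf.
have [q [M [q0 /(_ tt) bf]]] := @common_radius _ unit (fun=> f) (fun=> cf).
pose N' := Num.max N 1; have N0 : 0 < N' by rewrite lt_max ltr01 orbT.
pose t := Num.min 1 (q / N').
have t0 : 0 < t by rewrite lt_min ltr01 divr_gt0.
apply/convergentP; exists (fun=> t * r), M; split=> [_|]; first by rewrite mulr_gt0.
apply: bounded_at_subst bf => // i; first by rewrite mulr_gt0.
apply: (@bounded_at_bound _ _ _ (t * N')).
  by rewrite -ler_pdivlMr // ge_min lexx orbT.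
apply: bounded_at_shrink => //; first by rewrite ge_min lexx.
by apply: bounded_at_bound (bg i); rewrite le_max lexx.
Qed.

End TwoRings.

End Bounds.

(** * The trivial valuation *)

Section Trivial.
Variables (R : realType) (K : fieldType).

Definition triv_val (a : K) : R := (a != 0)%:R.

Lemma triv_val_ge0 a : 0 <= triv_val a. Proof. exact: ler0n. Qed.

Lemma triv_val_eq0 a : triv_val a = 0 <-> a = 0.
Proof.
by split=> [/eqP|->]; rewrite /triv_val ?eqxx // pnatr_eq0 eqb0 negbK => /eqP.
Qed.

Lemma triv_valM a b : triv_val (a * b) = triv_val a * triv_val b.
Proof. by rewrite /triv_val mulf_eq0 negb_or -natrM mulnb. Qed.

Lemma triv_valD a b : triv_val (a + b) <= triv_val a + triv_val b.
Proof.
rewrite /triv_val -natrD ler_nat; case: (eqVneq a 0) => [->|_]; first by rewrite add0r.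
by case: (_ != _).
Qed.

Definition trivial_valuation : realValuation R K :=
  RealValuation triv_val_ge0 triv_val_eq0 triv_valM triv_valD.

(** All values are at most one, so the series is dominated by a product of
    geometric series of ratio [1 / 2]. *)
Lemma convergent_trivial n (f : fps K n) : convergent trivial_valuation f.
Proof.
apply/convergentP; exists (fun=> 2^-1), (2 ^+ n); split=> [_|s us]; first by rewrite invr_gt0 ltr0n.
have p2 : (0 : R) < 2^-1 by rewrite invr_gt0 ltr0n.
pose N := (\sum_(a <- s) mdeg a)%N.
apply: (@le_trans _ _ (\sum_(a <- s) mon (fun=> 2^-1) a)).
  apply: ler_sum => a _; rewrite ler_piMl ?mon_ge0 //.
  by rewrite [leLHS]/(triv_val _) /triv_val lern1 leq_b1.
pose h (b : {ffun 'I_n -> 'I_N.+1}) : midx n := [ffun i => b i : nat].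
apply: (@le_trans _ _ (\sum_(a <- [seq h b | b : {ffun 'I_n -> 'I_N.+1}]) mon (fun=> 2^-1 : R) a)).
  apply: ler_sum_subset => // [|a as_|a]; last by rewrite mon_ge0.
    rewrite /image_mem map_inj_uniq ?enum_uniq // => b c /ffunP bc.
    by apply/ffunP => i; apply/val_inj; have := bc i; rewrite !ffunE.
  have le i : (a i < N.+1)%N.
    rewrite ltnS /N (big_rem a) //= (leq_trans _ (leq_addr _ _)) //.
    by rewrite /mdeg (bigD1 i) //= leq_addr.
  apply/fintype.imageP; exists [ffun i => Ordinal (le i)] => //.
  by apply/ffunP => i; rewrite !ffunE.
rewrite /image_mem big_map big_enum /=.
rewrite (eq_bigr (fun b : {ffun 'I_n -> 'I_N.+1} => \prod_i (2^-1 : R) ^+ b i)); last first.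
  by move=> b _; apply: eq_bigr => i _; rewrite ffunE.
rewrite -(bigA_distr_bigA (fun (i : 'I_n) (j : 'I_N.+1) => (2^-1 : R) ^+ j)) /=.
rewrite prodr_const card_ord lerXn2r ?nnegrE ?sumr_ge0 // => [j _|]; first exact/exprn_ge0/ltW.
have := subrX1 (2^-1 : R) N.+1.
have -> : (2^-1 : R) - 1 = - 2^-1.
  by rewrite [X in _ - X](splitr 1) mul1r opprD addrA subrr add0r.
move=> e; have -> : \sum_(i < N.+1) (2^-1 : R) ^+ i = 2 * (1 - 2^-1 ^+ N.+1).
  apply: (@mulfI _ (- 2^-1)); first by rewrite oppr_eq0 invr_eq0 pnatr_eq0.
  by rewrite -e mulrA mulNr mulVf ?pnatr_eq0 // mulN1r opprB.
by rewrite ler_piMr ?ler0n // gerBl exprn_ge0 ?(ltW p2).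
Qed.

End Trivial.

(** * Implicit functions *)

Section Joined.
Variables (T : Type) (n p : nat) (x : 'I_n -> T) (y : 'I_p -> T).

Definition joined (i : 'I_(n + p)) : T :=
  match split i with inl j => x j | inr j => y j end.

Lemma joinedl j : joined (lshift p j) = x j.
Proof. by rewrite /joined (unsplitK (inl j)). Qed.

Lemma joinedr j : joined (rshift n j) = y j.
Proof. by rewrite /joined (unsplitK (inr j)). Qed.

Lemma joinedP (P : T -> Prop) :
  (forall j, P (x j)) -> (forall j, P (y j)) -> forall i, P (joined i).
Proof. by rewrite /joined => Px Py i; case: split. Qed.

End Joined.

Section FixedPoint.
Variables (R : realType) (K : fieldType) (v : realValuation R K).

Lemma bounded_at_fvar n (eps : 'I_n -> R) i : (forall j, 0 < eps j) ->
  bounded_at v (fvar i : fps K n) eps (eps i).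
Proof.
move=> e0 s us.
apply: (@le_trans _ _ (\sum_(a <- munit i :: rem (munit i) s)
    v (coef (fvar i : fps K n) a) * mon eps a)).
  have [si|si] := boolP (munit i \in s); first by rewrite (perm_big _ (perm_to_rem si)).
  by rewrite rem_id // big_cons lerDr mulr_ge0 ?rval_ge0 ?mon_ge0.
rewrite big_cons /= eqxx rval1 mul1r big_seq big1 ?addr0 => [|a].
  rewrite /mon (bigD1 i) //= ffunE eqxx expr1 big1 ?mulr1 // => j /negPf ji.
  by rewrite ffunE ji.
by rewrite mem_rem_uniq // inE => /andP[/negPf -> _]; rewrite rval0 mul0r.
Qed.

(** Exchanging the factors of the monomial one by one, each difference has one
    factor [g_i - h_i] and [mdeg b - 1] factors of order one. *)
Lemma ordge_pw_sub m n (g h : 'I_m -> fps K n) N b :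
  (forall i, ordge 1 (g i)) -> (forall i, ordge 1 (h i)) ->
  (forall i, ordge N (g i - h i)) -> ordge (N + mdeg b).-1 (pw g b - pw h b).
Proof.
move=> g1 h1 gh; move eb : (mdeg b) => k.
elim: k b eb => [|k IH] b eb.
  by have /eqP := eb; rewrite mdeg_eq0 => /eqP ->; rewrite !pw0 subrr.
have [|i /munit_split[c bc]] := @mdeg_gt0 _ b; first by rewrite eb.
have ck : mdeg c = k by apply: succn_inj; rewrite -eb bc mdegD mdeg_munit addn1.
rewrite bc !pwD !pw_munit addnS /=.
rewrite (_ : _ - _ = pw g c * (g i - h i) + (pw g c - pw h c) * h i); last first.
  by rewrite mulrBr mulrBl addrA subrK.
apply: ordgeD.
  by rewrite addnC -{1}ck; apply: ordgeM; [apply: ordge_pw | apply: gh].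
apply: (@ordge_le _ _ _ ((N + k).-1 + 1)); first by rewrite addn1 leqSpred.
by apply: ordgeM; [apply: IH | apply: h1].
Qed.

Variables (n p : nat) (F : 'I_p -> fps K (n + p)).
Hypotheses (F0 : forall i, ordge 1 (F i))
  (F1 : forall i j, coef (F i) (munit (rshift n j)) = 0)
  (Fconv : forall i, convergent v (F i)).

Let along (y : 'I_p -> fps K n) := joined fvar y.

Let along1 y : (forall i, ordge 1 (y i)) -> forall i, ordge 1 (along y i).
Proof. by move=> y1; apply: joinedP => // j; apply: ordge_fvar. Qed.

(** [F] has no terms linear in the last [p] variables, so substituting for them
    gains one order of precision. *)
Let contraction N (y z : 'I_p -> fps K n) i :
  (forall i, ordge 1 (y i)) -> (forall i, ordge 1 (z i)) ->
  (forall i, ordge N (y i - z i)) ->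
  ordge N.+1 (subst (along y) (F i) - subst (along z) (F i)).
Proof.
move=> y1 z1 yz a aN; rewrite coefD coefN !(substE _ _ (leqnn _)) -sumrB.
have gE u : (forall i, ordge 1 (u i)) -> @mpart K n \o along u = along u.
  by move=> u1; apply/funext => j; apply: mpart_id; apply: along1.
rewrite !gE // big1 // => b _; rewrite -mulrBr -coefN -coefD.
case eb: (mdeg b) => [|[|k]].
- by move/eqP: eb; rewrite mdeg_eq0 => /eqP ->; rewrite !pw0 subrr coef0 mulr0.
- have [j ->] := mdeg1P eb; case: (splitP j) => l jl.
    have -> : j = lshift p l by apply/val_inj.
    by rewrite !pw_munit /along !joinedl subrr coef0 mulr0.
  have -> : j = rshift n l by apply/val_inj.
  by rewrite F1 mul0r.
have : ordge (N + mdeg b).-1 (pw (along y) b - pw (along z) b).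
  apply: ordge_pw_sub; [exact: along1 | exact: along1 |].
  rewrite /along => j; rewrite /joined; case: split => l; last exact: yz.
  by rewrite subrr.
move=> h; rewrite h ?mulr0 // eb !addnS /= (leq_trans aN) // ltnS leq_addr //.
Qed.

Let approx t : 'I_p -> fps K n :=
  iter t (fun y i => subst (along y) (F i)) (fun=> 0).

Let approx1 t i : ordge 1 (approx t i).
Proof. by case: t => [|t] //; apply: ordge_subst. Qed.

Let approx_step t i : ordge t.+1 (approx t.+1 i - approx t i).
Proof.
elim: t i => [|t IH] i; first by rewrite subr0; apply: approx1.
by apply: (@contraction _ (approx t.+1) (approx t)); [exact: approx1 | exact: approx1 | exact: IH].
Qed.

Let approx_stable i a t : (mdeg a <= t)%N ->
  coef (approx t i) a = coef (approx (mdeg a) i) a.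
Proof.
move=> /subnK <-; elim: (_ - _)%N => // k IH.
rewrite -IH addSn; apply/eqP; rewrite -subr_eq0 -coefN -coefD.
by rewrite approx_step // ltnS leq_addl.
Qed.

Let limit i : fps K n := Fps (fun a => coef (approx (mdeg a) i) a).

Let limit_approx t i : ordge t.+1 (limit i - approx t i).
Proof. by move=> a; rewrite ltnS => at_; rewrite coefD coefN (approx_stable i at_) subrr. Qed.

(** On a polydisc of radii [r tau^2] in the first and [r tau] in the last
    variables, the terms of [F] are smaller by a factor [tau^2] than on the
    polydisc of radius [r]. For small [tau] each iterate is hence bounded by
    [r tau], the radius at which it is substituted. *)
Let convergent_limit i : convergent v (limit i).
Proof.
have [r [M [r0 bF]]] := common_radius Fconv.
pose M' := Num.max M 1; have M0 : 0 < M' by rewrite lt_max ltr01 orbT.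
pose tau := Num.min 1 (r / M').
have t0 : 0 < tau by rewrite lt_min ltr01 divr_gt0.
have t1 : tau <= 1 by rewrite ge_min lexx.
have tM : tau * M' <= r by rewrite -ler_pdivlMr // ge_min lexx orbT.
pose w : 'I_(n + p) -> R := joined (fun=> tau ^+ 2) (fun=> tau).
have w0 j : 0 < w j by rewrite /w /joined; case: split => l; rewrite ?exprn_gt0.
have wt j : w j <= tau.
  by rewrite /w /joined; case: split => l //; rewrite expr2 ler_piMr // ltW.
have small j b : v (coef (F j) b) * mon w b <= v (coef (F j) b) * tau ^+ 2.
  case eb: (mdeg b) => [|[|k]].
  - by rewrite F0 ?eb // rval0 !mul0r.
  - have [l ->] := mdeg1P eb.
    have -> : mon w (munit l) = w l.
      rewrite /mon (bigD1 l) //= ffunE eqxx expr1 big1 ?mulr1 // => q /negPf ql.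
      by rewrite ffunE ql.
    case: (splitP l) => q lq.
      by rewrite (_ : l = lshift p q) /w ?joinedl //; apply/val_inj.
    by rewrite (_ : l = rshift n q) ?F1 ?rval0 ?mul0r //; apply/val_inj.
  rewrite ler_wpM2l ?rval_ge0 //; apply: (le_trans (le_mon b w0 wt)).
  by rewrite mon_const eb !exprS mulrA mulr1 ler_piMr ?mulr_ge0 ?(ltW t0) // exprn_ile1 ?(ltW t0).
pose d : 'I_(n + p) -> R := joined (fun=> r * tau ^+ 2) (fun=> r * tau).
have dE b : mon d b = r ^+ mdeg b * mon w b.
  rewrite -mon_const /mon -big_split; apply: eq_bigr => j _ /=.
  by rewrite -exprMn /d /w /joined; case: split.
have bFd j : bounded_at v (F j) d (r * tau).
  move=> s us; apply: (@le_trans _ _ (tau ^+ 2 * M')); last first.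
    by rewrite expr2 -mulrA mulrC ler_wpM2r // ltW.
  apply: (@le_trans _ _ (tau ^+ 2 * M)); last first.
    by rewrite ler_wpM2l ?exprn_ge0 ?(ltW t0) // le_max lexx.
  apply: le_trans (ler_wpM2l (exprn_ge0 2 (ltW t0)) (bF j s us)); rewrite mulr_sumr.
  apply: ler_sum => b _; rewrite dE mon_const mulrCA [leRHS]mulrA [leRHS]mulrC.
  by rewrite ler_wpM2l ?exprn_ge0 ?(ltW r0) // [leRHS]mulrC small.
have e0 (j : 'I_n) : 0 < r * tau ^+ 2 by rewrite mulr_gt0 ?exprn_gt0.
have bA t j : bounded_at v (approx t j) (fun=> r * tau ^+ 2) (r * tau).
  elim: t j => [|t IH] j.
    by move=> s _; rewrite big1 ?mulr_ge0 ?ltW // => a _; rewrite coef0 rval0 mul0r.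
  apply: bounded_at_subst (bFd j) => //; first exact/along1/approx1.
  rewrite /along /d /joined => l; case: split => q; last exact: IH.
  exact: (@bounded_at_fvar _ (fun=> r * tau ^+ 2)).
apply/convergentP; exists (fun=> r * tau ^+ 2), (r * tau); split=> // s us.
pose N := (\sum_(a <- s) mdeg a)%N; apply: le_trans (bA N i s us).
rewrite [leLHS]big_seq [leRHS]big_seq; apply: ler_sum => a as_ /=.
by rewrite (@approx_stable i a N) // /N (big_rem a) //= leq_addr.
Qed.

(** The implicit function theorem, for an equation solved for its linear part:
    [y = F(x, y)]. *)
Lemma fixed_point : exists y : 'I_p -> fps K n,
  [/\ forall i, ordge 1 (y i), forall i, convergent v (y i)
    & forall i, subst (joined fvar y) (F i) = y i].
Proof.
have l1 i : ordge 1 (limit i).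
  by have := @limit_approx 0%N i; rewrite subr0.
exists limit; split=> // i; apply/eqP; rewrite -subr_eq0; apply/eqP/ordge_eq0 => N.
rewrite (_ : _ - _ = (subst (along limit) (F i) - approx N.+1 i)
                     - (limit i - approx N.+1 i)); last first.
  by rewrite opprB addrA subrK.
apply: (@ordge_le _ _ _ N.+2); first by rewrite !leqW.
apply: ordgeB; last exact: limit_approx.
by apply: (@contraction _ limit (approx N)); [exact: l1 | exact: approx1 | exact: limit_approx].
Qed.

End FixedPoint.

(** * Coordinate changes *)

Lemma convergent_embed_vars (R : realType) (K : fieldType) (v : realValuation R K) n p (e : 'I_p -> 'I_n) (f : fps K p) :
  convergent v f -> convergent v (subst (fvar \o e) f).
Proof.
move=> cf; apply: convergent_subst => // i; first exact: ordge_fvar.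
exact: convergent_var.
Qed.

Section Units.
Variables (R : realType) (K : fieldType) (v : realValuation R K) (n : nat).

(** For [u = c (1 - w)] with [w] in the maximal ideal, [u^-1 = c^-1 (1 + y)]
    where [y = w + w y]. *)
Lemma convergent_inv (u : fps K n) : convergent v u -> coef u 0 != 0 ->
  exists2 w, convergent v w & u * w = 1.
Proof.
move=> cu u0; pose c := coef u 0; pose w := 1 - c^-1 *: u.
have cw : convergent v w by apply: convergentB; [exact: convergent1 | exact: convergentZ].
have w0 : coef w 0 = 0 by rewrite coefD coefN coefZ coef1 eqxx mulVf // subrr.
pose W : fps K (n + 1) := subst (fvar \o @lshift n 1) w.
pose F (_ : 'I_1) : fps K (n + 1) := W + W * fvar (rshift n ord0).
have cW : convergent v W by apply: convergent_embed_vars.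
have W0 : coef W 0 = 0 by rewrite coef0_subst.
have e1 j : ordge 1 ((fvar \o @lshift n 1) j : fps K _) by exact: ordge_fvar.
have [||i|y [y1 cy /(_ ord0)]] := @fixed_point _ _ v n 1 F.
- by move=> i; apply/ordge1P; rewrite coefD coef0M W0 mul0r addr0.
- move=> i j; rewrite coefD coef1M W0 mul0r addr0 (ordge1P (fvar _)).1; last exact: ordge_fvar.
  rewrite mulr0 addr0 coef1_subst // big1 // => l _.
  by rewrite coef1_fvar eq_rlshift mulr0.
- by apply: convergentD => //; apply: convergentM => //; apply: convergent_var.
have j1 l : ordge 1 (joined fvar y l : fps K n).
  by apply: joinedP => // j; apply: ordge_fvar.
rewrite substD substM subst_fvar // joinedr subst_comp //.
rewrite (eq_subst (h := fvar)) ?subst_id => [ey|l]; last first.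
  by rewrite /= subst_fvar // joinedl.
exists (c^-1 *: (1 + y ord0)).
  by apply: convergentZ; apply: convergentD; [exact: convergent1 | exact: cy].
have -> : u = c *: (1 - w).
  by rewrite opprB addrC subrK scalerA mulfV // scale1r.
rewrite -scalerAr -scalerAl scalerA mulVf // scale1r.
by rewrite mulrBl mul1r mulrDr mulr1 ey addrK.
Qed.

Definition coef_at0 (f : fps K n) : K := coef f 0.

Lemma coef_at0_is_zmod_morphism : zmod_morphism coef_at0.
Proof. by []. Qed.

Lemma coef_at0_is_monoid_morphism : monoid_morphism coef_at0.
Proof. by split=> [|f g]; [rewrite /coef_at0 coef1 eqxx | apply: coef0M]. Qed.

HB.instance Definition _ :=
  GRing.isZmodMorphism.Build (fps K n) K coef_at0 coef_at0_is_zmod_morphism.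
HB.instance Definition _ :=
  GRing.isMonoidMorphism.Build (fps K n) K coef_at0 coef_at0_is_monoid_morphism.

Lemma convergent_sign (b : bool) : convergent v ((-1) ^+ b : fps K n).
Proof. by apply: convergentX; apply: convergentN; apply: convergent1. Qed.

Lemma convergent_det k (M : 'M[fps K n]_k) :
  (forall i j, convergent v (M i j)) -> convergent v (\det M).
Proof.
move=> cM; apply: convergent_sum => s _; apply: convergentM.
  exact: convergent_sign.
by apply: big_ind => //; [exact: convergent1 | exact: convergentM].
Qed.

(** Cramer's rule, with the determinant inverted as a series. *)
Lemma convergent_mxinv k (M : 'M[fps K n]_k) :
  (forall i j, convergent v (M i j)) -> map_mx coef_at0 M \in unitmx ->
  exists2 N : 'M[fps K n]_k, (forall i j, convergent v (N i j)) & N *m M = 1%:M.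
Proof.
move=> cM; rewrite unitmxE det_map_mx unitfE => /(convergent_inv (convergent_det cM)).
move=> [w cw dw]; exists (w *: \adj M) => [i j|]; last first.
  by rewrite -scalemxAl mul_adj_mx scale_scalar_mx mulrC dw.
rewrite !mxE; apply: convergentM => //; apply: convergentM.
  exact: (convergentX _ (convergentN (convergent1 _ _))).
by apply: convergent_det => l q; rewrite !mxE.
Qed.

End Units.

Section CoordinateChanges.
Variables (R : realType) (K : fieldType) (v : realValuation R K) (n : nat).
Implicit Types (phi psi : 'I_n -> fps K n).

Definition coord_change phi :=
  [/\ forall i, ordge 1 (phi i), forall i, convergent v (phi i) & jac phi \in unitmx].

(** The equation [phi(y) = x] is equivalent to [y = y - J^-1 (phi(y) - x)], whose
    right-hand side has no terms linear in [y]. *)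
Lemma right_inverse phi : coord_change phi -> exists psi,
  coord_change psi /\ forall i, subst psi (phi i) = fvar i.
Proof.
case=> phi1 cphi Ju; pose J := jac phi; pose Y l : fps K (n + n) := fvar (rshift n l).
pose G j := subst Y (phi j) - fvar (lshift n j).
pose F i := Y i - \sum_j invmx J i j *: G j.
have Y1 l : ordge 1 (Y l) by exact: ordge_fvar.
have G1 j : ordge 1 (G j) by apply: ordgeB; [exact: ordge_subst | exact: ordge_fvar].
have [||i|psi [psi1 cpsi eqp]] := @fixed_point _ _ v n n F.
- by move=> i; apply: ordgeB => //; apply: ordge_sum => j _; apply: ordgeZ.
- move=> i l; rewrite coefD coefN coef_sum coef1_fvar eq_rshift.
  rewrite (eq_bigr (fun j => invmx J i j * J j l)) => [|j _].
    have := congr1 (fun A : 'M_n => A i l) (mulVmx Ju).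
    by rewrite !mxE => ->; rewrite eq_sym subrr.
  rewrite coefZ coefD coefN coef1_fvar eq_rlshift subr0 coef1_subst // (bigD1 l) //=.
  rewrite inj_eq; last exact: munit_inj.
  rewrite eqxx mulr1 big1 ?addr0 ?mxE // => q /negPf ql.
  by rewrite inj_eq ?eq_rshift ?[l == q]eq_sym ?ql ?mulr0 //; apply: munit_inj.
- apply: convergentB; first exact: convergent_var.
  apply: convergent_sum => j _; apply: convergentZ; apply: convergentB.
    by apply: convergent_subst => // l; apply: convergent_var.
  exact: convergent_var.
have j1 l : ordge 1 (joined fvar psi l : fps K n).
  by apply: joinedP => // j; apply: ordge_fvar.
have GE j : subst (joined fvar psi) (G j) = subst psi (phi j) - fvar j.
  rewrite substB subst_fvar // joinedl subst_comp //; congr (_ - _).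
  by apply: eq_subst => l; rewrite subst_fvar // joinedr.
have eq0 i : \sum_j invmx J i j *: (subst psi (phi j) - fvar j) = 0.
  have := eqp i; rewrite substB subst_fvar // joinedr subst_sum.
  under eq_bigr do rewrite substZ GE.
  by move=> e; apply/oppr_inj/(@addrI _ (psi i)); rewrite oppr0 addr0.
have inv i : subst psi (phi i) = fvar i.
  apply/eqP; rewrite -subr_eq0; apply/eqP.
  have : \sum_l J i l *: (\sum_j invmx J l j *: (subst psi (phi j) - fvar j)) = 0.
    by apply: big1 => l _; rewrite eq0 scaler0.
  under eq_bigr do rewrite scaler_sumr.
  rewrite exchange_big /=.
  under eq_bigr do (under eq_bigr do rewrite scalerA; rewrite -scaler_suml).
  rewrite (bigD1 i) //= [X in _ + X]big1 ?addr0 => [|j ji].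
    have := congr1 (fun A : 'M_n => A i i) (mulmxV Ju).
    by rewrite !mxE eqxx => ->; rewrite scale1r.
  have := congr1 (fun A : 'M_n => A i j) (mulmxV Ju).
  by rewrite !mxE eq_sym (negPf ji) => ->; rewrite scale0r.
exists psi; split=> //; split=> //.
have : J *m jac psi = 1%:M.
  rewrite -jac_subst // -(jac_fvar K n); congr jac.
  exact/funext.
by move/mulmx1_unit => [].
Qed.

(** The right inverse has a right inverse too, so it is two-sided. *)
Lemma inverse_function phi : coord_change phi -> exists psi,
  [/\ coord_change psi, cancel (subst phi) (subst psi) & cancel (subst psi) (subst phi)].
Proof.
move=> cc; have [psi [cpsi inv]] := right_inverse cc.
have [chi [cchi inv']] := right_inverse cpsi.
have K1 : cancel (subst phi) (subst psi).
  by case: cc => phi1 _ _ f; rewrite subst_comp // (eq_subst _ inv) subst_id.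
have K2 : cancel (subst psi) (subst chi).
  by case: cpsi => psi1 _ _ f; rewrite subst_comp // (eq_subst _ inv') subst_id.
by exists psi; split=> // f; apply: (can_inj K2); apply: K1.
Qed.

Definition requiv (f g : fps K n) := exists2 phi, coord_change phi & subst phi f = g.

Lemma requiv_sym f g : requiv f g -> requiv g f.
Proof.
by case=> phi /inverse_function[psi [cpsi K1 _]] <-; exists psi => //; apply: K1.
Qed.

Lemma requiv_trans f g h : requiv f g -> requiv g h -> requiv f h.
Proof.
case=> phi [p1 cp Jp] <- [psi [q1 cq Jq] <-].
exists (fun i => subst psi (phi i)); last by rewrite subst_comp.
split=> [i|i|]; [exact: ordge_subst | exact: convergent_subst |].
by rewrite jac_subst // unitmx_mul Jp.
Qed.

End CoordinateChanges.

(** * Derivatives *)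

Section Derivative.
Variables (K : fieldType) (n : nat).
Implicit Types (f g : fps K n) (i j l : 'I_n).

Lemma fderivD i f g : fderiv i (f + g) = fderiv i f + fderiv i g.
Proof. by apply/fpsP => a /=; rewrite mulrnDl. Qed.

Lemma fderivZ i c f : fderiv i (c *: f) = c *: fderiv i f.
Proof. by apply/fpsP => a /=; rewrite mulrnAr. Qed.

Lemma fderivN i f : fderiv i (- f) = - fderiv i f.
Proof. by apply/fpsP => a /=; rewrite mulNrn. Qed.

Lemma fderivB i f g : fderiv i (f - g) = fderiv i f - fderiv i g.
Proof. by rewrite fderivD fderivN. Qed.

Lemma fderiv0 i : fderiv i (0 : fps K n) = 0.
Proof. by apply/fpsP => a /=; rewrite mul0rn. Qed.

Lemma fderiv_sum i (I : Type) (s : seq I) (P : pred I) (F : I -> fps K n) :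
  fderiv i (\sum_(j <- s | P j) F j) = \sum_(j <- s | P j) fderiv i (F j).
Proof. by apply: (big_morph (fderiv i) (@fderivD i) (fderiv0 i)). Qed.

Lemma fvarI i : injective ( *%R (fvar i : fps K n)).
Proof.
move=> f g fg; apply/fpsP => a.
by have := congr1 (fun h => coef h (munit i + a)) fg; rewrite !coef_monoM.
Qed.

(** The product rule is immediate for [x_i d/dx_i], which multiplies the
    coefficient of [x^a] by [a_i]. *)
Lemma fderivM i f g : fderiv i (f * g) = fderiv i f * g + f * fderiv i g.
Proof.
have eulerE h : fvar i * fderiv i h = Fps (fun a => coef h a *+ a i).
  apply/fpsP => a; have [a0|/munit_split[b ->]] := posnP (a i).
    rewrite coef_monoM0 /= ?a0 ?mulr0n // => c ac.
    by move: a0; rewrite ac maddE ffunE eqxx.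
  by rewrite [in LHS]addrC coef_monoM /= maddE ffunE eqxx addn1.
apply: (@fvarI i); rewrite mulrDr mulrA [fvar i * (f * _)]mulrCA !eulerE.
apply/fpsP => a; transitivity (coef (f * g) a *+ a i); first by [].
rewrite coefD !coefM -sumrMnl -big_split.
rewrite big_seq [RHS]big_seq; apply: eq_bigr => p; rewrite mem_splits => /eqP <-.
by rewrite maddE /= mulrnDr mulrnAl mulrnAr.
Qed.

Lemma fderiv1 i : fderiv i (1 : fps K n) = 0.
Proof.
apply: (@addrI _ (fderiv i (1 : fps K n))); rewrite addr0.
by have := fderivM i 1 1; rewrite !mulr1 mul1r.
Qed.

Lemma fderiv_fvar i j : fderiv i (fvar j : fps K n) = (i == j)%:R.
Proof.
apply/fpsP => a /=; case: (eqVneq i j) => [->|ij].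
  rewrite coef1 addrC -[X in _ == X]addr0 (inj_eq (@maddI _ _)).
  by case: eqP => [->|_]; rewrite ?ffunE ?mul0rn.
case: eqP => [/ffunP/(_ i)|_]; rewrite ?mul0rn //.
by rewrite maddE !ffunE eqxx (negPf ij) addn1.
Qed.

Lemma ordge_fderiv N i f : ordge N.+1 f -> ordge N (fderiv i f).
Proof. by move=> Nf a aN /=; rewrite Nf ?mul0rn // mdegD mdeg_munit addn1. Qed.

Lemma coef0_fderiv i f : coef (fderiv i f) 0 = coef f (munit i).
Proof. by rewrite /= ffunE add0r. Qed.

Lemma fderivX2 i f : fderiv i (f ^+ 2) = 2%:R *: (f * fderiv i f).
Proof. by rewrite expr2 fderivM mulrC -mulr2n scaler_nat. Qed.

End Derivative.

(** As for [local_hom_eq], the defect [E] satisfies [E (x_l q) = phi_l * E q] and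
    kills constants, hence gains one order at each division by variables. *)
Lemma chain_rule (K : fieldType) (m n : nat) (phi : 'I_m -> fps K n) (f : fps K m) i :
  (forall l, ordge 1 (phi l)) ->
  fderiv i (subst phi f) = \sum_j subst phi (fderiv j f) * fderiv i (phi j).
Proof.
move=> p1; apply/eqP; rewrite -subr_eq0; apply/eqP/ordge_eq0 => N.
pose E h := fderiv i (subst phi h) - \sum_j subst phi (fderiv j h) * fderiv i (phi j).
have ED h h' : E (h + h') = E h + E h'.
  rewrite /E substD fderivD [X in _ - X](_ : _ =
    (\sum_j subst phi (fderiv j h) * fderiv i (phi j))
    + (\sum_j subst phi (fderiv j h') * fderiv i (phi j))).
    by rewrite opprD addrACA.
  by rewrite -big_split; apply: eq_bigr => j _; rewrite fderivD substD mulrDl.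
have EC c : E c%:A = 0.
  rewrite /E substZ subst1 fderivZ fderiv1 scaler0 sub0r big1 ?oppr0 // => j _.
  by rewrite fderivZ fderiv1 scaler0 subst0 mul0r.
have EX l q : E (fvar l * q) = phi l * E q.
  rewrite /E substM subst_fvar // fderivM mulrBr mulr_sumr.
  rewrite (eq_bigr (fun j => (j == l)%:R * (subst phi q * fderiv i (phi j))
      + phi l * (subst phi (fderiv j q) * fderiv i (phi j)))) => [|j _].
    rewrite big_split /= (bigD1 l) //= eqxx mul1r big1 ?addr0 => [|j /negPf ->].
      by rewrite mulrC opprD addrACA subrr add0r.
    by rewrite mul0r.
  rewrite fderivM substD !substM subst_fvar // fderiv_fvar mulrDl -!mulrA.
  by case: eqP => _; rewrite ?subst1 ?subst0.
have E0 : E 0 = 0 by rewrite -(scale0r 1) EC.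
rewrite -/(E f); elim: N f => [|N IH] f; first exact: ordge0.
rewrite (hadamard f) ED EC add0r (big_morph E ED E0); apply: ordge_sum => l _.
by rewrite EX; apply: (@ordgeM _ _ 1).
Qed.

Section Hessian.
Variable K : fieldType.

Lemma hessianE n (f : fps K n) i j : hessian f i j = coef (fderiv j f) (munit i).
Proof. by rewrite mxE coef0_fderiv. Qed.

Lemma hessianD n (f g : fps K n) : hessian (f + g) = hessian f + hessian g.
Proof. by apply/matrixP => i j; rewrite [RHS]mxE !hessianE fderivD coefD. Qed.

Lemma hessianB n (f g : fps K n) : hessian (f - g) = hessian f - hessian g.
Proof. by apply/matrixP => i j; rewrite [RHS]mxE [X in _ = _ + X]mxE !hessianE fderivB coefD coefN. Qed.

Lemma hessian_ordge3 n (f : fps K n) : ordge 3 f -> hessian f = 0.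
Proof.
move=> f3; apply/matrixP => i j; rewrite hessianE [RHS]mxE.
by rewrite (@ordge_fderiv K n 2 j f f3) ?mdeg_munit.
Qed.

(** The entries of the Hessian are the quadratic coefficients times one or two. *)
Lemma ordge3P n (f : fps K n) : 2%N \notin [pchar K] ->
  ordge 2 f -> hessian f = 0 -> ordge 3 f.
Proof.
move=> c2 f2 H0 a; rewrite ltnS leq_eqVlt => /predU1P[/mdeg2P[i [j ->]]|]; last exact: f2.
have := congr1 (fun A : 'M_n => A i j) H0; rewrite hessianE mxE /= ffunE.
case: eqP => _ //= /eqP; rewrite -mulr_natr mulf_eq0 => /orP[/eqP //|two0].
by move: c2; rewrite inE /= two0.
Qed.

(** The terms with second derivatives of [phi] carry first derivatives of [f],
    which vanish at the origin. *)
Lemma hessian_subst m n (phi : 'I_m -> fps K n) (f : fps K m) :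
  (forall l, ordge 1 (phi l)) -> ordge 2 f ->
  hessian (subst phi f) = (jac phi)^T *m hessian f *m jac phi.
Proof.
move=> p1 f2; apply/matrixP => i j; rewrite hessianE chain_rule // coef_sum mxE.
apply: eq_bigr => l _; rewrite coef1M coef0_subst !coef0_fderiv.
rewrite (f2 (munit l)) ?mdeg_munit // mul0r addr0 coef1_subst //.
rewrite !mxE; congr (_ * _); apply: eq_bigr => q _.
by rewrite -hessianE !mxE mulrC.
Qed.

End Hessian.

(** * Restriction to a coordinate subspace *)

Section Restriction.
Variables (K : fieldType) (m n : nat) (e : 'I_n -> 'I_m).
Hypothesis e_inj : injective e.
Implicit Types (f : fps K m) (g : fps K n).

Definition restr i : fps K n := if [pick j | e j == i] is Some j then fvar j else 0.

Lemma restr_e j : restr (e j) = fvar j.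
Proof. by rewrite /restr; case: pickP => [l /eqP/e_inj->|/(_ j)]; rewrite ?eqxx. Qed.

Lemma restr_off i : off e i -> restr i = 0.
Proof.
by rewrite /off /restr => ei; case: pickP => // l /eqP le; rewrite -le codom_f in ei.
Qed.

Lemma ordge_restr i : ordge 1 (restr i).
Proof. by rewrite /restr; case: pickP => // j _; apply: ordge_fvar. Qed.

Lemma convergent_restr (R : realType) (v : realValuation R K) i : convergent v (restr i).
Proof.
by rewrite /restr; case: pickP => [j _|_]; [exact: convergent_var | exact: convergent0].
Qed.

Lemma subst_restr_e j : subst restr (fvar (e j)) = fvar j.
Proof. by rewrite subst_fvar; [exact: restr_e | exact: ordge_restr]. Qed.

Lemma subst_restr_off i : off e i -> subst restr (fvar i) = 0.
Proof. by move=> oi; rewrite subst_fvar; [exact: restr_off | exact: ordge_restr]. Qed.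

Lemma embed1 j : ordge 1 ((fvar \o e) j : fps K m).
Proof. exact: ordge_fvar. Qed.

Lemma restr_embed g : subst restr (subst (fvar \o e) g) = g.
Proof.
rewrite subst_comp; last exact: embed1.
rewrite (eq_subst (h := fvar)) ?subst_id // => j.
exact: subst_restr_e.
Qed.

Lemma restr_split f :
  f = subst (fvar \o e) (subst restr f)
      + \sum_(i | off e i) fvar i * divided (off e) i f.
Proof.
rewrite {1}(embed_split e_inj f); congr (subst _ _ + _).
rewrite {2}(embed_split e_inj f) substD restr_embed subst_sum big1 ?addr0 // => i oi.
by rewrite substM subst_restr_off ?mul0r.
Qed.

Lemma fderiv_embed_off g i : off e i -> fderiv i (subst (fvar \o e) g) = 0.
Proof.
move=> oi; rewrite chain_rule; last exact: embed1.
apply: big1 => j _; rewrite /= fderiv_fvar; case: eqP => [ij|]; last by rewrite mulr0.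
by move: oi; rewrite /off ij codom_f.
Qed.

(** The square of the ideal of the subspace consists of the series vanishing
    on it together with their transversal derivatives. *)
Lemma second_order_split f :
  subst restr f = 0 -> (forall i, off e i -> subst restr (fderiv i f) = 0) ->
  f = \sum_(i | off e i) \sum_(j | off e j)
        fvar i * fvar j * divided (off e) j (divided (off e) i f).
Proof.
move=> f0 f1; rewrite {1}(restr_split f) f0 subst0 add0r; apply: eq_bigr => i oi.
have q0 : subst restr (divided (off e) i f) = 0.
  rewrite -(f1 i oi) {2}(restr_split f) f0 subst0 add0r fderiv_sum subst_sum.
  rewrite (bigD1 i) //= fderivM fderiv_fvar eqxx mul1r substD substM.
  rewrite subst_restr_off // mul0r addr0.
  rewrite big1 ?addr0 // => l /andP[ol li].
  rewrite fderivM fderiv_fvar eq_sym (negPf li) mul0r add0r substM.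
  by rewrite subst_restr_off ?mul0r.
rewrite {1}(restr_split (divided _ i f)) q0 subst0 add0r mulr_sumr.
by apply: eq_bigr => j _; rewrite mulrA.
Qed.

End Restriction.

(** * Taylor expansion of order two *)

Section Taylor.
Variables (R : realType) (K : fieldType) (v : realValuation R K) (n : nat).

Let x (i : 'I_n) : fps K (n + n) := fvar (lshift n i).
Let y (i : 'I_n) : fps K (n + n) := fvar (rshift n i).

Lemma off_lshift : off (@lshift n n) =1 (fun i => i \in codom (@rshift n n)).
Proof.
move=> i; rewrite /off -[i]splitK; case: split => j /=.
  rewrite codom_f; apply/esym/negbTE/codomP => -[l /eqP].
  by rewrite eq_lrshift.
by rewrite codom_f; apply/codomP => -[l /eqP]; rewrite eq_rlshift.
Qed.

Lemma sum_off_lshift (V : nmodType) (F : 'I_(n + n) -> V) :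
  \sum_(i | off (@lshift n n) i) F i = \sum_j F (rshift n j).
Proof.
rewrite big_mkcond big_split_ord /= big1 ?add0r => [|j _].
  by apply: eq_bigr => j _; rewrite off_lshift codom_f.
by rewrite /off codom_f.
Qed.

(** The difference of both sides, remainder omitted, vanishes for [y = 0]
    together with its derivatives with respect to [y]. *)
Lemma taylor2 (f : fps K n) : convergent v f -> exists Rm : 'I_n -> 'I_n -> fps K (n + n),
  [/\ forall l q, convergent v (Rm l q), ordge 3 f -> forall l q, ordge 1 (Rm l q)
    & subst (fun i => x i + y i) f
      = subst x f + \sum_l y l * subst x (fderiv l f)
        + \sum_l \sum_q y l * y q * Rm l q].
Proof.
move=> cf.
have x1 i : ordge 1 (x i) by exact: ordge_fvar.
have y1 i : ordge 1 (y i) by exact: ordge_fvar.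
have xy1 i : ordge 1 (x i + y i) by exact: ordgeD.
have cx i : convergent v (x i) by exact: convergent_var.
have cy i : convergent v (y i) by exact: convergent_var.
pose D := subst (fun i => x i + y i) f - subst x f - \sum_l y l * subst x (fderiv l f).
have inj := @lshift_inj n n.
pose rho := restr K (@lshift n n).
have rx g : subst rho (subst x g) = g by exact: restr_embed.
have ry l : subst rho (y l) = 0.
  by rewrite subst_restr_off // off_lshift codom_f.
have rxy g : subst rho (subst (fun i => x i + y i) g) = g.
  rewrite subst_comp // -[RHS]rx [RHS]subst_comp //.
  by apply: eq_subst => i; rewrite substD ry addr0.
have D0 : subst rho D = 0.
  rewrite !substB rxy rx subrr sub0r subst_sum big1 ?oppr0 // => l _.
  by rewrite substM ry mul0r.
have D1 i : off (@lshift n n) i -> subst rho (fderiv i D) = 0.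
  rewrite off_lshift => /codomP[l ->]; rewrite !fderivB !substB.
  have -> : fderiv (rshift n l) (subst x f) = 0.
    by apply: fderiv_embed_off; rewrite off_lshift codom_f.
  rewrite subst0 subr0 chain_rule // subst_sum fderiv_sum subst_sum -sumrB.
  apply: big1 => j _; rewrite substM rxy fderivM !substD.
  rewrite [fderiv _ (subst x _)]fderiv_embed_off ?off_lshift ?codom_f // mulr0 subst0 addr0.
  rewrite substM rx fderivD /x /y !fderiv_fvar eq_rlshift add0r mulrC.
  by rewrite subrr.
exists (fun l q => divided (off (@lshift n n)) (rshift n q)
                     (divided (off (@lshift n n)) (rshift n l) D)); split.
- move=> l q; do 2!apply: convergent_divided; apply: convergentB; first apply: convergentB.
  + by apply: convergent_subst => // i; apply: convergentD.
  + exact: convergent_subst.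
  apply: convergent_sum => j _; apply: convergentM => //; apply: convergent_subst => //.
  exact: convergent_deriv.
- move=> f3 l q; do 2!apply: ordge_divided; apply: ordgeB; first apply: ordgeB.
  + exact: ordge_subst.
  + exact: ordge_subst.
  apply: ordge_sum => j _; apply: (@ordgeM _ _ 1) => //.
  by apply: ordge_subst; apply: ordge_fderiv.
have := second_order_split inj D0 D1; rewrite sum_off_lshift.
under eq_bigr do rewrite sum_off_lshift.
by move=> <-; rewrite /D -[_ - _ - _]addrA -opprD [RHS]addrC subrK.
Qed.

End Taylor.

(** * Absorbing quadratic expressions in the derivatives *)

Section Absorb.
Variables (R : realType) (K : fieldType) (v : realValuation R K) (n : nat).
Variables (f : fps K n) (d : 'I_n -> 'I_n -> fps K n).
Hypotheses (f2 : ordge 2 f) (cf : convergent v f) (cd : forall l q, convergent v (d l q)).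
Hypothesis alt : (forall l q, coef (d l q) 0 = 0) \/ ordge 3 f.

(* The unknown matrix has the entries [b_lq = d_lq(0) + y_(l,q)]; the [y_(l,q)]
   follow the variables [x] as further variables, numbered by [ix]. In these
   variables, [B] is the matrix and [Y] the displacement of the coordinates. *)
Let I : finType := ('I_n * 'I_n)%type.
Let p := #|I|.
Let ix l q : 'I_p := enum_rank ((l, q) : I).
Let d0 l q : K := coef (d l q) 0.

Let X (i : 'I_n) : fps K (n + p) := fvar (lshift p i).
Let B l q : fps K (n + p) := (d0 l q)%:A + fvar (rshift n (ix l q)).
Let Y l : fps K (n + p) := \sum_q B l q * subst X (fderiv q f).

Let X1 i : ordge 1 (X i). Proof. exact: ordge_fvar. Qed.
Let cX i : convergent v (X i). Proof. exact: convergent_var. Qed.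
Let f'1 q : ordge 1 (fderiv q f). Proof. exact: ordge_fderiv. Qed.
Let cf' q : convergent v (fderiv q f). Proof. exact: convergent_deriv. Qed.

Let Y1 l : ordge 1 (Y l).
Proof. by apply: ordge_sum => q _; apply: ordgeMl; apply: ordge_subst. Qed.

Let cB l q : convergent v (B l q).
Proof.
apply: convergentD; last exact: convergent_var.
by apply: convergentZ; apply: convergent1.
Qed.

Let cY l : convergent v (Y l).
Proof.
by apply: convergent_sum => q _; apply: convergentM => //; apply: convergent_subst.
Qed.

Let XY1 i : ordge 1 (joined X Y i).
Proof. by rewrite /joined; case: split. Qed.

Let cXY i : convergent v (joined X Y i).
Proof. by rewrite /joined; case: split. Qed.

Let coef0_B l q : coef (B l q) 0 = d0 l q.
Proof.
by rewrite coefD coefZ coef1 eqxx mulr1 (ordge1P (fvar _)).1 ?addr0 //; apply: ordge_fvar.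
Qed.

Let coefX_r i j : coef (X i) (munit (rshift n j)) = 0.
Proof. by rewrite coef1_fvar eq_rlshift. Qed.

Let coef_substX_r g j : coef (subst X g) (munit (rshift n j)) = 0.
Proof. by rewrite coef1_subst // big1 // => i _; rewrite coefX_r mulr0. Qed.

Let coefY_r l j : coef (Y l) (munit (rshift n j)) = 0.
Proof.
rewrite coef_sum big1 // => q _; rewrite coef1M coef_substX_r mulr0 addr0.
by rewrite coef0_subst (ordge1P (fderiv q f)).1 ?mulr0.
Qed.

Variable Rm : 'I_n -> 'I_n -> fps K (n + n).
Hypotheses (cR : forall l q, convergent v (Rm l q))
  (R1 : ordge 3 f -> forall l q, ordge 1 (Rm l q))
  (taylor : subst (fun i => fvar (lshift n i) + fvar (rshift n i)) f
      = subst (fun i => fvar (lshift n i)) f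
        + \sum_l fvar (rshift n l) * subst (fun i => fvar (lshift n i)) (fderiv l f)
        + \sum_l \sum_q fvar (rshift n l) * fvar (rshift n q) * Rm l q).

(* The equation [b + b^T R b = d], solved for [y]. Either [b(0)] or [R(0)] is
   zero, so the quadratic term contributes neither a constant nor terms linear
   in [y]. *)
Let Q s t l q := B s l * B t q * subst (joined X Y) (Rm s t).

Let F (i : 'I_p) : fps K (n + p) :=
  let: (l, q) := (enum_val i : I) in
  subst X (d l q) - (d0 l q)%:A - \sum_s \sum_t Q s t l q.

Let F0 i : ordge 1 (F i).
Proof.
rewrite /F; case: (enum_val i : I) => l q; apply/ordge1P.
rewrite !(coefD, coefN) coef0_subst coefZ coef1 eqxx mulr1 subrr sub0r coef_sum.
rewrite big1 ?oppr0 // => s _; rewrite coef_sum big1 // => t _.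
rewrite !coef0M !coef0_B coef0_subst; case: alt => [h|/R1 h].
  by rewrite /d0 h !mul0r.
by rewrite (ordge1P (Rm s t)).1 ?mulr0.
Qed.

Let F1 i j : coef (F i) (munit (rshift n j)) = 0.
Proof.
rewrite /F; case: (enum_val i : I) => l q.
rewrite !(coefD, coefN) coef_substX_r coefZ coef1 (negPf (munit_neq0 _)) mulr0 subrr sub0r.
rewrite coef_sum big1 ?oppr0 // => s _; rewrite coef_sum big1 // => t _.
rewrite coef1M [coef (subst _ _) (munit _)](_ : _ = 0) ?mulr0 ?addr0; last first.
  rewrite coef1_subst // big1 // => r _; rewrite /joined.
  by case: split => r'; rewrite ?coefX_r ?coefY_r mulr0.
rewrite coef0_subst coef1M !coef0_B; case: alt => [h|/R1 h].
  by rewrite /d0 !h mulr0 !mul0r addr0 mul0r.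
by rewrite (ordge1P (Rm s t)).1 ?mulr0.
Qed.

Let cF i : convergent v (F i).
Proof.
rewrite /F; case: (enum_val i : I) => l q.
apply: convergentB; first apply: convergentB.
- exact: convergent_subst.
- by apply: convergentZ; apply: convergent1.
apply: convergent_sum => s _; apply: convergent_sum => t _; apply: convergentM.
  exact: convergentM.
exact: convergent_subst.
Qed.

Lemma absorb_aux :
  requiv v f (f + \sum_l \sum_q d l q * (fderiv l f * fderiv q f)).
Proof.
have [y [y1 cy eqy]] := fixed_point F0 F1 cF.
pose b l q := (d0 l q)%:A + y (ix l q).
pose eta l := \sum_q b l q * fderiv q f.
pose S := joined (fvar : 'I_n -> fps K n) y.
have S1 i : ordge 1 (S i) by apply: joinedP => // j; apply: ordge_fvar.
have SX g : subst S (subst X g) = g.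
  rewrite subst_comp // -[RHS]subst_id; apply: eq_subst => i.
  by rewrite subst_fvar // /S joinedl.
have SB l q : subst S (B l q) = b l q.
  by rewrite substD substZ subst1 subst_fvar // /S joinedr.
have SY l : subst S (Y l) = eta l.
  by rewrite subst_sum; apply: eq_bigr => q _; rewrite substM SB SX.
have eta1 l : ordge 1 (eta l) by apply: ordge_sum => q _; apply: ordgeMl.
pose T := joined (fvar : 'I_n -> fps K n) eta.
have T1 i : ordge 1 (T i) by apply: joinedP => // j; apply: ordge_fvar.
have SXY g : subst S (subst (joined X Y) g) = subst T g.
  rewrite subst_comp //; apply: eq_subst => i; rewrite /T /joined; case: split => j //.
  by rewrite subst_fvar // /S joinedl.
have eqb l q : b l q + \sum_s \sum_t b s l * b t q * subst T (Rm s t) = d l q.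
  have := eqy (ix l q); rewrite /F enum_rankK !substB SX substZ subst1 subst_sum.
  rewrite (eq_bigr (fun s => \sum_t b s l * b t q * subst T (Rm s t))) => [e|s _].
    by rewrite /b -e -addrA subrK addrC subrK.
  by rewrite subst_sum; apply: eq_bigr => t _; rewrite !substM !SB SXY.
exists (fun i => fvar i + eta i).
  have cb l q : convergent v (b l q).
    by apply: convergentD => //; apply: convergentZ; apply: convergent1.
  split=> [i|i|].
  - by apply: ordgeD => //; apply: ordge_fvar.
  - apply: convergentD; first exact: convergent_var.
    by apply: convergent_sum => q _; apply: convergentM.
  suff -> : jac (fun i => fvar i + eta i) = 1%:M by exact: unitmx1.
  rewrite -(jac_fvar K n); apply/matrixP => i j; rewrite !mxE coefD coef_sum big1 ?addr0 //.
  move=> q _; rewrite coef1M [coef (fderiv q f) 0](ordge1P _).1 // mulr0 add0r.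
  rewrite /b coefD coefZ coef1 eqxx mulr1 (ordge1P (y _)).1 // addr0; case: alt => [h|h].
    by rewrite /d0 h mul0r.
  by rewrite (@ordge_fderiv _ _ 2 q f h) ?mulr0 ?mdeg_munit.
have xy1 i : ordge 1 (fvar (lshift n i) + fvar (rshift n i) : fps K (n + n)).
  by apply: ordgeD; apply: ordge_fvar.
have Tl g : subst T (subst (fun i => fvar (lshift n i)) g) = g.
  rewrite subst_comp => [|i]; last exact: ordge_fvar.
  rewrite -[RHS]subst_id; apply: eq_subst => i.
  by rewrite subst_fvar // /T joinedl.
have Tr l : subst T (fvar (rshift n l)) = eta l by rewrite subst_fvar // /T joinedr.
transitivity (subst T (subst (fun i => fvar (lshift n i) + fvar (rshift n i)) f)).
  rewrite subst_comp //; apply: eq_subst => i.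
  by rewrite substD Tr subst_fvar // /T joinedl.
rewrite taylor !substD !subst_sum Tl -addrA; congr (_ + _).
under eq_bigr do rewrite substM Tr Tl.
under [X in _ + X]eq_bigr do (rewrite subst_sum; under eq_bigr do rewrite !substM !Tr).
under [RHS]eq_bigr do under eq_bigr do rewrite -eqb mulrDl.
under [RHS]eq_bigr do rewrite big_split.
rewrite big_split; congr (_ + _) => /=.
  apply: eq_bigr => l _; rewrite mulr_suml; apply: eq_bigr => q _.
  by rewrite -mulrA [fderiv q f * _]mulrC.
transitivity (\sum_s \sum_t \sum_l \sum_q
   b s l * b t q * subst T (Rm s t) * (fderiv l f * fderiv q f)).
  apply: eq_bigr => s _; apply: eq_bigr => t _; rewrite /eta big_distrlr mulr_suml.
  apply: eq_bigr => l _; rewrite mulr_suml; apply: eq_bigr => q _.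
  by rewrite [RHS]mulrAC; congr (_ * _); rewrite mulrACA.
rewrite (eq_bigr _ (fun s _ => exchange_big _ _ _ _ _ _)) /= exchange_big /=.
apply: eq_bigr => l _.
rewrite (eq_bigr _ (fun s _ => exchange_big _ _ _ _ _ _)) /= exchange_big /=.
apply: eq_bigr => q _; rewrite mulr_suml; apply: eq_bigr => s _.
by rewrite mulr_suml.
Qed.

End Absorb.

Lemma absorb (R : realType) (K : fieldType) (v : realValuation R K) n
    (f : fps K n) (d : 'I_n -> 'I_n -> fps K n) :
  ordge 2 f -> convergent v f -> (forall l q, convergent v (d l q)) ->
  (forall l q, coef (d l q) 0 = 0) \/ ordge 3 f ->
  requiv v f (f + \sum_l \sum_q d l q * (fderiv l f * fderiv q f)).
Proof.
move=> f2 cf cd alt; have [Rm [cR R1 taylor]] := taylor2 cf.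
exact: (absorb_aux f2 cf cd alt cR R1 taylor).
Qed.

(** * Residual parts *)

Section Splitting.
Variables (R : realType) (K : fieldType) (v : realValuation R K).
Hypothesis char_neq2 : 2%N \notin [pchar K].
Variables (k r n : nat) (e1 : 'I_k -> 'I_n) (e2 : 'I_r -> 'I_n).
Hypotheses (e1_inj : injective e1) (e2_inj : injective e2).
Hypothesis cover : forall i, off e2 i = (i \in codom e1).

Lemma two_neq0 : (2%:R : K) != 0.
Proof. by move: char_neq2; rewrite inE. Qed.

Lemma sum_codom (V : nmodType) s m (e : 'I_s -> 'I_m) (F : 'I_m -> V) : injective e ->
  \sum_(i in codom e) F i = \sum_j F (e j).
Proof.
move=> ei; have u : uniq (codom e) by rewrite /codom /image_mem map_inj_uniq ?enum_uniq.
by rewrite -(big_uniq _ u); rewrite /codom /image_mem big_map big_enum.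
Qed.

Lemma sum_off (V : nmodType) (F : 'I_n -> V) :
  \sum_(i | off e2 i) F i = \sum_j F (e1 j).
Proof. by rewrite (eq_bigl _ _ cover) sum_codom. Qed.

Lemma sum_split (V : nmodType) (F : 'I_n -> V) :
  \sum_i F i = \sum_j F (e1 j) + \sum_l F (e2 l).
Proof.
rewrite (bigID (off e2)) /= sum_off; congr (_ + _); rewrite -sum_codom //.
by apply: eq_bigl => i; rewrite negbK.
Qed.

Lemma off_e1 j : off e2 (e1 j). Proof. by rewrite cover codom_f. Qed.

Lemma e1_neq_e2 j l : (e1 j == e2 l) = false.
Proof. by apply/eqP => e; have := off_e1 j; rewrite e /off codom_f. Qed.

Lemma mxsub_mul p q s t (f : 'I_s -> 'I_p) (g : 'I_t -> 'I_q) (M : 'M[K]_(p, n))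
    (N : 'M[K]_(n, q)) :
  mxsub f g (M *m N) = mxsub f e1 M *m mxsub e1 g N + mxsub f e2 M *m mxsub e2 g N.
Proof.
apply/matrixP => i j; rewrite !mxE sum_split; congr (_ + _);
by apply: eq_bigr => l _; rewrite !mxE.
Qed.

Definition quad (a : 'I_k -> K) : fps K n := \sum_i a i *: fvar (e1 i) ^+ 2.

Definition normal a (g : fps K r) : fps K n := quad a + subst (fvar \o e2) g.

Lemma ordge_quad a : ordge 2 (quad a).
Proof.
by apply: ordge_sum => i _; apply: ordgeZ; apply: (@ordgeX K n 1 (fvar (e1 i)) 2); apply: ordge_fvar.
Qed.

Lemma convergent_quad a : convergent v (quad a).
Proof.
by apply: convergent_sum => i _; apply: convergentZ; apply: convergentX; apply: convergent_var.
Qed.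

Lemma fderiv_quad a j :
  fderiv j (quad a) = \sum_i (2%:R * a i * (j == e1 i)%:R) *: fvar (e1 i).
Proof.
rewrite fderiv_sum; apply: eq_bigr => i _.
rewrite fderivZ fderivX2 fderiv_fvar scalerA [a i * _]mulrC.
by case: eqP => _; rewrite ?mulr1 // !mulr0 scaler0 scale0r.
Qed.

Lemma fderiv_quad1 a i : fderiv (e1 i) (quad a) = (2%:R * a i) *: fvar (e1 i).
Proof.
rewrite fderiv_quad (bigD1 i) //= eqxx mulr1 big1 ?addr0 // => j ji.
by rewrite (inj_eq e1_inj) eq_sym (negPf ji) mulr0 scale0r.
Qed.

Lemma fderiv_quad2 a l : fderiv (e2 l) (quad a) = 0.
Proof.
by rewrite fderiv_quad big1 // => j _; rewrite eq_sym e1_neq_e2 mulr0 scale0r.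
Qed.

Lemma fderiv_embed1 g i : fderiv (e1 i) (subst (fvar \o e2) g : fps K n) = 0.
Proof. by apply: fderiv_embed_off; apply: off_e1. Qed.

Lemma fderiv_embed2 g l :
  fderiv (e2 l) (subst (fvar \o e2) g) = subst (fvar \o e2) (fderiv l g) :> fps K n.
Proof.
rewrite chain_rule; last exact: embed1.
rewrite (bigD1 l) //= fderiv_fvar eqxx mulr1 big1 ?addr0 // => j jl.
by rewrite fderiv_fvar (inj_eq e2_inj) eq_sym (negPf jl) mulr0.
Qed.

Lemma normal_fderiv1 a g i : fderiv (e1 i) (normal a g) = (2%:R * a i) *: fvar (e1 i).
Proof. by rewrite fderivD fderiv_quad1 fderiv_embed1 addr0. Qed.

Lemma normal_fderiv2 a g l :
  fderiv (e2 l) (normal a g) = subst (fvar \o e2) (fderiv l g).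
Proof. by rewrite fderivD fderiv_quad2 fderiv_embed2 add0r. Qed.

Lemma hessian_normal a g : ordge 3 g -> hessian (normal a g) = hessian (quad a).
Proof. move=> g3; rewrite hessianD [hessian (subst _ _)]hessian_ordge3 ?addr0 //.
exact: ordge_subst. Qed.

Lemma hessian_quad11 a :
  mxsub e1 e1 (hessian (quad a)) = diag_mx (\row_i (2%:R * a i)).
Proof.
apply/matrixP => i j; rewrite mxE hessianE fderiv_quad1 coefZ coef1_fvar !mxE.
by rewrite (inj_eq e1_inj) -mulr_natr; case: eqP => [->|]; rewrite ?mulr1 ?mulr0.
Qed.

Lemma hessian_quad12 a : mxsub e1 e2 (hessian (quad a)) = 0.
Proof.
by apply/matrixP => i j; rewrite mxE hessianE fderiv_quad2 mxE.
Qed.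

Lemma hessian_quad2 a s (h : 'I_s -> 'I_n) : mxsub e2 h (hessian (quad a)) = 0.
Proof.
apply/matrixP => i j; rewrite mxE hessianE fderiv_quad coef_sum [RHS]mxE big1 // => l _.
by rewrite coefZ coef1_fvar [e2 i == _]eq_sym e1_neq_e2 mulr0.
Qed.

Lemma diag_unit (a : 'I_k -> K) : (forall i, a i != 0) ->
  diag_mx (\row_i (2%:R * a i)) \in unitmx.
Proof.
move=> a0; rewrite unitmxE det_diag unitfE; apply/prodf_neq0 => i _.
by rewrite mxE mulf_neq0 ?two_neq0.
Qed.

(** The restriction to the subspace of the last variables. *)
Let rho := restr K e2.

Let rho1 i : ordge 1 (rho i). Proof. exact: ordge_restr. Qed.

Lemma rho_e1 j : subst rho (fvar (e1 j)) = 0.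
Proof. by apply: subst_restr_off; apply: off_e1. Qed.

Lemma rho_quad a : subst rho (quad a) = 0.
Proof.
by rewrite subst_sum big1 // => i _; rewrite substZ substX rho_e1 expr0n scaler0.
Qed.

(** Comparing Hessians, the linear part of a coordinate change that carries one
    normal form into another is block triangular. *)
Lemma normal_jac a a' g0 g1 phi : (forall i, a i != 0) -> (forall i, a' i != 0) ->
  ordge 3 g0 -> ordge 3 g1 -> coord_change v phi ->
  subst phi (normal a g0) = normal a' g1 ->
  mxsub e1 e1 (jac phi) \in unitmx /\ mxsub e2 e2 (jac phi) \in unitmx.
Proof.
move=> a0 a'0 g03 g13 [phi1 _ Ju] eqn; set J := jac phi in Ju *.
have n2 : ordge 2 (normal a g0).
  by apply: ordgeD; [exact: ordge_quad | apply: ordge_subst; apply: ordge_le g03].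
have := hessian_subst phi1 n2; rewrite eqn !hessian_normal // => eqH.
have HJ s (h : 'I_s -> 'I_n) : mxsub e1 h (hessian (quad a'))
    = (mxsub e1 e1 J)^T *m diag_mx (\row_i (2%:R * a i)) *m mxsub e1 h J.
  rewrite eqH mxsub_mul mxsub_mul [mxsub e1 e2 (_ *m _)]mxsub_mul.
  rewrite !hessian_quad2 hessian_quad12 hessian_quad11 !mulmx0 !addr0 mul0mx addr0.
  by rewrite trmx_mxsub.
have := HJ _ e1; rewrite hessian_quad11 => eq11.
have := diag_unit a'0; rewrite eq11 unitmx_mul => /andP[u1 u2]; split=> //.
have J12 : mxsub e1 e2 J = 0.
  apply: (can_inj (mulKmx u1)); rewrite -HJ hessian_quad12 mulmx0 //.
have := congr1 (mxsub e1 e2) (mulmxV Ju); rewrite mxsub_mul J12 mul0mx addr0.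
have -> : mxsub e1 e2 (1%:M : 'M[K]_n) = 0.
  by apply/matrixP => i j; rewrite !mxE e1_neq_e2.
move/(congr1 (mulmx (invmx (mxsub e1 e1 J)))); rewrite mulKmx // mulmx0 => I12.
have := congr1 (mxsub e2 e2) (mulmxV Ju); rewrite mxsub_mul I12 mulmx0 add0r.
have -> : mxsub e2 e2 (1%:M : 'M[K]_n) = 1%:M.
  by apply/matrixP => i j; rewrite !mxE (inj_eq e2_inj).
by move/mulmx1_unit => [].
Qed.

(** The components [sigma] of [phi] in the first variables, restricted to the
    subspace, are combinations of the [(dg0/dx_l)(chi)]: the equation [eqM] is
    the derivative of [phi (normal a g0) = normal a' g1] transversal to the
    subspace, and the matrix [M] is invertible because it is so at the origin. *)
Lemma residual_unique a a' g0 g1 : (forall i, a i != 0) -> (forall i, a' i != 0) ->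
  ordge 3 g0 -> ordge 3 g1 -> convergent v g0 ->
  requiv v (normal a g0) (normal a' g1) -> requiv v g0 g1.
Proof.
move=> a0 a'0 g03 g13 cg0 [phi cc eqn].
have [u1 u2] := normal_jac a0 a'0 g03 g13 cc eqn.
have [phi1 cphi _] := cc.
have crho i : convergent v (rho i) by exact: convergent_restr.
pose sigma j := subst rho (phi (e1 j)); pose chi l := subst rho (phi (e2 l)).
have sphi h : subst rho (subst phi (subst (fvar \o e2) h)) = subst chi h.
  rewrite [subst phi _]subst_comp; last exact: embed1.
  rewrite (eq_subst (h := phi \o e2)) => [|l]; last by rewrite /= subst_fvar.
  by rewrite subst_comp // => l; apply: phi1.
have cchi : coord_change v chi.
  split=> [l|l|]; [exact: ordge_subst | exact: convergent_subst |].
  suff -> : jac chi = mxsub e2 e2 (jac phi) by [].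
  apply/matrixP => l l'; rewrite !mxE coef1_subst // sum_split big1 ?add0r => [|j _].
    rewrite (bigD1 l') //= /rho restr_e // coef1_fvar eqxx mulr1 big1 ?addr0 // => q ql.
    by rewrite restr_e // coef1_fvar eq_sym (negPf ql) mulr0.
  by rewrite /rho restr_off ?mulr0 //; apply: off_e1.
have eqA : \sum_j a j *: sigma j ^+ 2 + subst chi g0 = g1.
  have := congr1 (subst rho) eqn; rewrite /normal !substD sphi rho_quad add0r.
  rewrite restr_embed // => <-; congr (_ + _); rewrite !subst_sum.
  by apply: eq_bigr => j _; rewrite !substZ !substX [subst phi (fvar _)]subst_fvar.
pose M : 'M[fps K r]_k := \matrix_(i, j) subst rho (fderiv (e1 i) (phi (e1 j))).
pose N i l := subst rho (fderiv (e1 i) (phi (e2 l))).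
have eqM i : \sum_j M i j * ((2%:R * a j) *: sigma j)
           = - \sum_l N i l * subst chi (fderiv l g0).
  have := congr1 (fun h => subst rho (fderiv (e1 i) h)) eqn.
  rewrite /= normal_fderiv1 substZ rho_e1 scaler0 chain_rule // subst_sum sum_split.
  move=> /eqP; rewrite addr_eq0 => /eqP e; rewrite -[LHS]opprK; congr (- _).
  apply: oppr_inj; rewrite opprK; apply: etrans (etrans e _).
    apply: eq_bigr => j _; rewrite mxE normal_fderiv1 substM !substZ.
    by rewrite [subst phi (fvar _)]subst_fvar // mulrC.
  congr (- _); apply: eq_bigr => l _.
  by rewrite normal_fderiv2 substM sphi mulrC.
have cM i j : convergent v (M i j).
  by rewrite mxE; apply: convergent_subst => //; apply: convergent_deriv.
have cN i l : convergent v (N i l).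
  by apply: convergent_subst => //; apply: convergent_deriv.
have [|W cW WM] := convergent_mxinv cM.
  rewrite (_ : map_mx _ M = (mxsub e1 e1 (jac phi))^T) ?unitmx_tr //.
  by apply/matrixP => i j; rewrite !mxE /coef_at0 coef0_subst coef0_fderiv.
pose p j l := - (2%:R * a j)^-1 *: \sum_i W j i * N i l.
have cp j l : convergent v (p j l).
  apply: convergentZ; apply: convergent_sum => i _; exact: convergentM.
have sigmaE j : sigma j = \sum_l p j l * subst chi (fderiv l g0).
  have a2 : 2%:R * a j != 0 by rewrite mulf_neq0 ?two_neq0.
  have : (2%:R * a j) *: sigma j = \sum_i W j i * \sum_q M i q * ((2%:R * a q) *: sigma q).
    under eq_bigr do rewrite mulr_sumr.
    rewrite exchange_big /=.
    rewrite (eq_bigr (fun q => (W *m M) j q * ((2%:R * a q) *: sigma q))) => [|q _].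
      rewrite WM (bigD1 j) //= mxE eqxx mul1r big1 ?addr0 // => q qj.
      by rewrite mxE eq_sym (negPf qj) mul0r.
    by rewrite mxE mulr_suml; apply: eq_bigr => i _; rewrite mulrA.
  move/(congr1 ( *:%R (2%:R * a j)^-1)); rewrite scalerA mulVf // scale1r => ->.
  under eq_bigr do rewrite eqM mulrN mulr_sumr.
  rewrite sumrN scalerN -scaleNr exchange_big /= scaler_sumr; apply: eq_bigr => l _.
  by rewrite /p -scalerAl mulr_suml; congr (_ *: _); apply: eq_bigr => i _; rewrite mulrA.
have [omega [comega _ K2]] := inverse_function cchi.
have [omega1 comega' _] := comega.
pose d l q := subst omega (\sum_j a j *: (p j l * p j q)).
have cd l q : convergent v (d l q).
  apply: convergent_subst => //; apply: convergent_sum => j _; apply: convergentZ.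
  exact: convergentM.
have g02 : ordge 2 g0 by apply: ordge_le g03.
apply: requiv_trans (absorb g02 cg0 cd (or_intror g03)) _; exists chi => //.
rewrite -eqA substD addrC; congr (_ + _); rewrite subst_sum.
under eq_bigr do (rewrite subst_sum; under eq_bigr do rewrite !substM K2 mulr_suml).
under [RHS]eq_bigr do rewrite sigmaE expr2 big_distrlr /= scaler_sumr.
rewrite [RHS]exchange_big; apply: eq_bigr => l _ /=.
under [RHS]eq_bigr do rewrite scaler_sumr.
rewrite [RHS]exchange_big; apply: eq_bigr => q _ /=.
by apply: eq_bigr => j _; rewrite -scalerAl mulrACA.
Qed.

End Splitting.

(** * Diagonalization of symmetric matrices *)

Section Congruence.
Variable K : fieldType.
Hypothesis char_neq2 : 2%N \notin [pchar K].

(** If the diagonal vanishes, the form takes the value [2 H_ij] at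
    [e_i + e_j]. *)
Lemma anisotropic_vector n (H : 'M[K]_n) : H^T = H -> H != 0 ->
  exists u : 'rV_n, (u *m H *m u^T) 0 0 != 0.
Proof.
move=> sH H0.
have form i j : ((delta_mx 0 i : 'rV_n) *m H *m (delta_mx 0 j : 'rV_n)^T) 0 0 = H i j.
  by rewrite -rowE trmx_delta -colE !mxE.
have [[i hi]|nd] := pselect (exists i, H i i != 0).
  by exists (delta_mx 0 i); rewrite form.
have d0 i : H i i = 0 by apply/eqP/negPn/negP => hi; apply: nd; exists i.
have [i [j hij]] : exists i j, H i j != 0.
  have [//|nh] := pselect (exists i j, H i j != 0).
  case/eqP: H0; apply/matrixP => i j; rewrite [RHS]mxE.
  by apply/eqP/negPn/negP => hij; apply: nh; exists i, j.
exists (delta_mx 0 i + delta_mx 0 j).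
rewrite [X in _ *m X]raddfD /= mulmxDl mulmxDl !mulmxDr.
have addE (A B : 'M[K]_1) : (A + B) 0 0 = A 0 0 + B 0 0 by rewrite mxE.
have hji : H j i = H i j by rewrite -{1}sH mxE.
rewrite !addE !form !d0 addr0 add0r hji -mulr2n -mulr_natr.
exact: mulf_neq0 hij (two_neq0 char_neq2).
Qed.

(** Lagrange's reduction: an anisotropic vector splits off, which lowers the
    rank by one. *)
Lemma diag_congruence n k (H : 'M[K]_n) : H^T = H -> \rank H = k ->
  exists (U : 'M_(k, n)) (b : 'rV_k), (forall i, b 0 i != 0) /\ U *m H *m U^T = diag_mx b.
Proof.
elim: k H => [|k IH] H sH rH.
  by exists 0, 0; split=> [[]//|]; apply/matrixP => -[].
have [|u uc] := anisotropic_vector sH; first by rewrite -mxrank_eq0 rH.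
set c := (u *m H *m u^T) 0 0 in uc.
have cE : u *m H *m u^T = c%:M by rewrite [LHS]mx11_scalar.
have uHT : (u *m H)^T = H *m u^T by rewrite trmx_mul sH.
have HuT : (H *m u^T)^T = u *m H by rewrite -uHT trmxK.
(* [Q] projects along [u] onto its orthogonal complement, and [H'] agrees with
   [H] on the complement and has [u] in its radical. *)
pose Q := 1%:M - c^-1 *: (H *m u^T *m u).
pose H' := Q *m H.
have H'E : H' = H - c^-1 *: (H *m u^T *m (u *m H)).
  by rewrite /H' mulmxBl mul1mx -scalemxAl !mulmxA.
have sH' : H'^T = H'.
  by rewrite H'E linearB linearZ /= trmx_mul uHT HuT sH.
have uH' : u *m H' = 0.
  rewrite H'E mulmxBr -scalemxAr [X in _ *: X]mulmxA [u *m (H *m _)]mulmxA cE mul_scalar_mx scalerA mulVf //.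
  by rewrite scale1r subrr.
have H'u : H' *m u^T = 0 by rewrite -sH' -trmx_mul uH' trmx0.
have rH' : \rank H' = k.
  apply/eqP; rewrite eqn_leq -ltnS -rH; apply/andP; split.
    rewrite ltn_neqAle mxrankS ?submxMl // andbT; apply/negP => /eqP re.
    have /submxP[X HX] : (H <= H')%MS.
      by rewrite -(geq_leqif (mxrank_leqif_sup (submxMl Q H))) -/H' re.
    have HX' : H = H' *m X^T by rewrite -{1}sH {1}HX trmx_mul sH'.
    by case/eqP: uc; rewrite /c HX' mulmxA uH' !mul0mx mxE.
  rewrite -ltnS -rH (_ : H = H' + c^-1 *: (H *m u^T *m (u *m H))); last by rewrite H'E subrK.
  apply: leq_trans (mxrank_add _ _) _; rewrite -(addn1 (\rank H')) leq_add2l.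
  by rewrite scalemxAl mulmx_max_rank.
have [U' [b' [b'0 U'E]]] := IH H' sH' rH'.
have HQ : H *m Q^T = H' by rewrite -{1}sH -trmx_mul -/H' sH'.
pose U'' := U' *m Q.
have UuE : u *m H *m U''^T = 0.
  by rewrite trmx_mul -!mulmxA [H *m (_ *m _)]mulmxA HQ mulmxA uH' mul0mx.
have UuE' : U'' *m H *m u^T = 0.
  by rewrite -[RHS]trmx0 -UuE !trmx_mul !trmxK sH !mulmxA.
have U''E : U'' *m H *m U''^T = diag_mx b'.
  have HQ' : H' *m Q^T = H'.
    have -> : Q^T = 1%:M - c^-1 *: (u^T *m (u *m H)).
      by rewrite linearB linearZ /= trmx1 trmx_mul HuT.
    by rewrite mulmxBr mulmx1 -scalemxAr [H' *m (u^T *m _)]mulmxA H'u mul0mx scaler0 subr0.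
  have -> : U'' *m H = U' *m H' by rewrite /U'' -mulmxA.
  by rewrite trmx_mul mulmxA -[U' *m H' *m Q^T]mulmxA HQ'.
suff [U [b h]] : exists (U : 'M_(1 + k, n)) (b : 'rV_(1 + k)),
    (forall i, b 0 i != 0) /\ U *m H *m U^T = diag_mx b by exists U, b.
exists (col_mx u U''), (row_mx c%:M b'); split=> [i|].
  by rewrite mxE; case: split => j //; rewrite ord1 mxE eqxx.
rewrite mul_col_mx tr_col_mx mul_col_row cE UuE UuE' U''E diag_mx_row.
by congr block_mx; apply/matrixP => i j; rewrite !mxE !ord1.
Qed.

End Congruence.

(** * Existence of the normal form *)

Section Existence.
Variables (R : realType) (K : fieldType) (v : realValuation R K).
Hypothesis char_neq2 : 2%N \notin [pchar K].
Variables (k r n : nat) (e1 : 'I_k -> 'I_n) (e2 : 'I_r -> 'I_n).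
Hypotheses (e1_inj : injective e1) (e2_inj : injective e2).
Hypothesis cover : forall i, off e2 i = (i \in codom e1).

Let sumE := fun V F => @sum_split k r n e1 e2 e1_inj e2_inj cover V F.
Let e12 := @e1_neq_e2 k r n e1 e2 cover.
Let two0 := two_neq0 char_neq2.

Lemma indexP i : (exists j, i = e1 j) \/ (exists l, i = e2 l).
Proof.
have [|] := boolP (i \in codom e2); first by case/codomP => l; right; exists l.
by rewrite -/(off e2 i) cover => /codomP[j]; left; exists j.
Qed.

Definition glue (T : nmodType) (x : 'I_k -> T) (y : 'I_r -> T) (i : 'I_n) : T :=
  if [pick j | e1 j == i] is Some j then x j
  else if [pick l | e2 l == i] is Some l then y l else 0.

Lemma glue1 (T : nmodType) x y j : @glue T x y (e1 j) = x j.
Proof. by rewrite /glue; case: pickP => [q /eqP/e1_inj->|/(_ j)]; rewrite ?eqxx. Qed.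

Lemma glue2 (T : nmodType) x y l : @glue T x y (e2 l) = y l.
Proof.
rewrite /glue; case: pickP => [q|_]; first by rewrite e12.
by case: pickP => [q /eqP/e2_inj->|/(_ l)]; rewrite ?eqxx.
Qed.

Lemma hessian_sym m (f : fps K m) : (hessian f)^T = hessian f.
Proof.
apply/matrixP => i j; rewrite [LHS]mxE !hessianE /= addrC !ffunE.
by rewrite [i == j]eq_sym.
Qed.

(** An orthogonal family of anisotropic vectors, completed by a basis of the
    radical, is a basis of the whole space. *)
Lemma hessian_congruence (H : 'M[K]_n) : H^T = H -> \rank H = k ->
  exists P (a : 'I_k -> K), [/\ P \in unitmx, forall i, a i != 0
    & P^T *m H *m P = hessian (quad e1 a)].
Proof.
move=> sH rH; have [U [b [b0 UE]]] := diag_congruence char_neq2 sH rH.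
have nE : (n - k = r)%N.
  have := sumE (fun=> 1%N); rewrite !sum1_card !card_ord => {1}->.
  by rewrite [X in (X - k)%N]/(k + r)%N addKn.
have [N [fN NH]] : exists N : 'M[K]_(r, n), row_free N /\ N *m H = 0.
  rewrite -nE -rH -mxrank_ker; exists (row_base (kermx H)).
  by split; [exact: row_base_free | apply/sub_kermxP; rewrite eq_row_base].
have HN : H *m N^T = 0 by rewrite -{1}sH -trmx_mul NH trmx0.
pose S1 : 'M[K]_(n, k) := \matrix_(i, j) (i == e1 j)%:R.
pose S2 : 'M[K]_(n, r) := \matrix_(i, j) (i == e2 j)%:R.
pose W := S1 *m U + S2 *m N.
have WHE : W *m H = S1 *m (U *m H).
  by rewrite mulmxDl -!mulmxA NH mulmx0 addr0.
exists W^T, (fun i => b 0 i / 2%:R); split.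
- rewrite unitmx_tr -row_free_unit; apply: inj_row_free => x xW.
  have x1 : x *m S1 = 0.
    have : x *m W *m H *m U^T = 0 by rewrite xW !mul0mx.
    rewrite -[x *m W *m H]mulmxA WHE !mulmxA -[_ *m U *m H]mulmxA -mulmxA UE => e.
    have ub : diag_mx b \in unitmx.
      by rewrite unitmxE det_diag unitfE; apply/prodf_neq0 => i _.
    by apply: (can_inj (mulmxK ub)); rewrite e mul0mx.
  have x2 : x *m S2 = 0.
    apply: (row_free_inj fN); rewrite mul0mx; move: xW.
    by rewrite mulmxDr !mulmxA x1 mul0mx add0r.
  apply/matrixP => i0 i; rewrite ord1 [RHS]mxE.
  have pick1 s (e : 'I_s -> 'I_n) (S : 'M[K]_(n, s)) j :
      S = \matrix_(i, j) (i == e j)%:R -> x *m S = 0 -> x 0 (e j) = 0.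
    move=> -> /matrixP/(_ 0 j); rewrite !mxE (bigD1 (e j)) //= mxE eqxx mulr1.
    by rewrite big1 ?addr0 // => q /negPf qj; rewrite mxE qj mulr0.
  by case: (indexP i) => -[j ->]; [apply: pick1 x1 | apply: pick1 x2].
- by move=> i; rewrite mulf_neq0 ?invr_eq0.
have UHW : U *m H *m W^T = diag_mx b *m S1^T.
  rewrite linearD /= !trmx_mul mulmxDr !mulmxA UE -[U *m H *m N^T]mulmxA HN.
  by rewrite mulmx0 mul0mx addr0.
rewrite trmxK WHE -mulmxA UHW mulmxA.
apply/matrixP => i j; rewrite hessianE fderiv_quad coef_sum !mxE; apply: eq_bigr => l _.
rewrite mul_mx_diag !mxE coefZ coef1_fvar [2%:R * _]mulrC divfK //.
by rewrite [RHS]mulrC mulrA.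
Qed.

Lemma linear_change (P : 'M[K]_n) : P \in unitmx ->
  exists2 phi, coord_change v phi & jac phi = P.
Proof.
move=> uP; have jE : jac (fun i => \sum_j P i j *: fvar j) = P.
  apply/matrixP => i j; rewrite mxE coef_sum (bigD1 j) // coefZ coef1_fvar eqxx mulr1.
  rewrite big1 => [|l /andP[_ lj]]; first exact: addr0.
  by rewrite coefZ coef1_fvar eq_sym (negPf lj) mulr0.
exists (fun i => \sum_j P i j *: fvar j) => //; split=> [i|i|]; last by rewrite jE.
- by apply: ordge_sum => j _; apply: ordgeZ; apply: ordge_fvar.
- by apply: convergent_sum => j _; apply: convergentZ; apply: convergent_var.
Qed.

(** The critical points of [f] on the fibres of the projection to the last
    variables form a graph; it is tangent to the subspace of these variables,
    as the Hessian has no mixed entries. *)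
Lemma critical_graph a (f : fps K n) : (forall i, a i != 0) -> ordge 2 f -> convergent v f ->
  hessian f = hessian (quad e1 a) ->
  exists psi : 'I_k -> fps K r, [/\ forall i, ordge 2 (psi i), forall i, convergent v (psi i)
    & forall i, subst (glue psi fvar) (fderiv (e1 i) f) = 0].
Proof.
move=> a0 f2 cf Hf.
have a2 i : 2%:R * a i != 0 by rewrite mulf_neq0.
have lin1 i m : coef (fderiv (e1 i) f) (munit m) = 2%:R * a i * (m == e1 i)%:R.
  by rewrite -hessianE Hf hessianE fderiv_quad1 // coefZ coef1_fvar.
have lin2 i p (h : 'I_n -> fps K p) j : (forall m, ordge 1 (h m)) ->
    coef (subst h (fderiv (e1 i) f)) (munit j) = 2%:R * a i * coef (h (e1 i)) (munit j).
  move=> h1; rewrite coef1_subst //; under eq_bigr do rewrite lin1.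
  rewrite (bigD1 (e1 i)) //= eqxx mulr1 big1 ?addr0 // => m /negPf ->.
  by rewrite mulr0 mul0r.
pose kappa : 'I_n -> fps K (r + k) :=
  glue (fun i => fvar (rshift r i)) (fun l => fvar (lshift k l)).
have kappa1 i : ordge 1 (kappa i).
  by case: (indexP i) => -[j ->]; rewrite /kappa (glue1, glue2); apply: ordge_fvar.
have ckappa i : convergent v (kappa i).
  by case: (indexP i) => -[j ->]; rewrite /kappa (glue1, glue2); apply: convergent_var.
have f'1 i : ordge 1 (fderiv i f) by apply: ordge_fderiv.
have cf' i : convergent v (fderiv i f) by apply: convergent_deriv.
pose F i := fvar (rshift r i) - (2%:R * a i)^-1 *: subst kappa (fderiv (e1 i) f).
have [i|i j|i|psi [psi1 cpsi eqp]] := @fixed_point _ _ v r k F.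
- apply: ordgeB; [exact: ordge_fvar | apply: ordgeZ; exact: ordge_subst].
- rewrite coefD coefN coefZ lin2 // /kappa glue1 !coef1_fvar mulKf //.
  exact: subrr.
- apply: convergentB; first exact: convergent_var.
  by apply: convergentZ; apply: convergent_subst.
have j1 l : ordge 1 (joined fvar psi l : fps K r).
  by apply: joinedP => // j; apply: ordge_fvar.
have g1 i : ordge 1 (glue psi fvar i).
  by case: (indexP i) => -[j ->]; rewrite (glue1, glue2) //; apply: ordge_fvar.
have crit i : subst (glue psi fvar) (fderiv (e1 i) f) = 0.
  have := eqp i; rewrite substB substZ subst_fvar // joinedr subst_comp //.
  rewrite (eq_subst (h := glue psi fvar)) => [e|q]; last first.
    by case: (indexP q) => -[j ->]; rewrite /kappa !(glue1, glue2) subst_fvar // (joinedl, joinedr).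
  have : (2%:R * a i)^-1 *: subst (glue psi fvar) (fderiv (e1 i) f) = 0.
    by apply/oppr_inj/(@addrI _ (psi i)); rewrite oppr0 addr0.
  by move/(congr1 ( *:%R (2%:R * a i))); rewrite scalerA mulfV // scale1r scaler0.
exists psi; split=> // i b; rewrite ltnS leq_eqVlt => /predU1P[/mdeg1P[l ->]|]; last exact: psi1.
have := congr1 (fun h => coef h (munit l)) (crit i); rewrite lin2 // glue1.
by move/eqP; rewrite mulf_eq0 (negPf (a2 i)) => /eqP.
Qed.

(** After straightening the graph of critical points, the series vanishes on the
    subspace together with its transversal derivatives once the normal form
    [normal a g] is subtracted; the difference [D] is thus quadratic in the first
    variables, with coefficients of order one, and [absorb] applies. *)
Lemma normal_form (f : fps K n) : ordge 2 f -> convergent v f -> \rank (hessian f) = k ->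
  exists a g, [/\ forall i, a i != 0, ordge 3 g, convergent v g
    & requiv v f (normal e1 e2 a g)].
Proof.
move=> f2 cf rH; have [P [a [uP a0 PE]]] := hessian_congruence (hessian_sym f) rH.
have [la cla jla] := linear_change uP; have [la1 cla' _] := cla.
pose f1 := subst la f.
have f12 : ordge 2 f1 by exact: ordge_subst.
have cf1 : convergent v f1 by exact: convergent_subst.
have Hf1 : hessian f1 = hessian (quad e1 a) by rewrite hessian_subst // jla.
have [psi [psi2 cpsi crit]] := critical_graph a0 f12 cf1 Hf1.
pose E := @subst K r n (fvar \o e2).
pose rho := restr K e2.
have rho1 i : ordge 1 (rho i) by exact: ordge_restr.
have crho i : convergent v (rho i) by exact: convergent_restr.
pose tau := glue (fun j => fvar (e1 j) + E (psi j)) (fun l => fvar (e2 l)).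
have tau1 i : ordge 1 (tau i).
  case: (indexP i) => -[j ->]; rewrite /tau (glue1, glue2); last exact: ordge_fvar.
  apply: ordgeD; first exact: ordge_fvar.
  by apply: ordge_subst; apply: ordge_le (psi2 j).
have jtau : jac tau = 1%:M.
  rewrite -(jac_fvar K n); apply/matrixP => i m; rewrite !mxE.
  case: (indexP i) => -[j ->]; rewrite /tau (glue1, glue2) // coefD.
  have /(_ (munit m)) -> : ordge 2 (E (psi j)) by exact: ordge_subst.
    exact: addr0.
  by rewrite mdeg_munit.
have ctau : coord_change v tau.
  split=> // [i|]; last by rewrite jtau unitmx1.
  case: (indexP i) => -[j ->]; rewrite /tau (glue1, glue2); last exact: convergent_var.
  by apply: convergentD; [exact: convergent_var | exact: convergent_embed_vars].
have [_ ctau' _] := ctau.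
pose f2' := subst tau f1; pose g := subst rho f2'.
have f2'2 : ordge 2 f2' by exact: ordge_subst.
have Hf2 : hessian (f2' - quad e1 a) = 0.
  by rewrite hessianB hessian_subst // jtau trmx1 mul1mx mulmx1 Hf1 subrr.
have q2 := ordge_quad e1 a.
have f2'3 : ordge 3 (f2' - quad e1 a) by apply: ordge3P => //; apply: ordgeB.
have rq : subst rho (quad e1 a) = 0 by exact: (rho_quad cover).
have g3 : ordge 3 g.
  have : ordge 3 (subst rho (f2' - quad e1 a)) by exact: ordge_subst.
  by rewrite substB rq subr0.
have cf2' : convergent v f2' by exact: convergent_subst.
have cg : convergent v g by exact: convergent_subst.
have n2 : ordge 2 (normal e1 e2 a g).
  by apply: ordgeD => //; apply: ordge_subst; apply: ordge_le g3.
have cn : convergent v (normal e1 e2 a g).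
  by apply: convergentD; [exact: convergent_quad | exact: convergent_embed_vars].
pose D := f2' - normal e1 e2 a g.
have D3 : ordge 3 D by rewrite /D /normal opprD addrA; apply: ordgeB => //; apply: ordge_subst.
have cD : convergent v D by exact: convergentB.
have rD : subst rho D = 0 by rewrite substB substD rq restr_embed // add0r subrr.
have rdD i : off e2 i -> subst rho (fderiv i D) = 0.
  rewrite cover => /codomP[j ->]; rewrite fderivB normal_fderiv1 // substB substZ.
  rewrite [subst rho (fvar _)](rho_e1 _ cover) scaler0 subr0 chain_rule // subst_sum.
  rewrite (bigD1 (e1 j)) //= big1 ?addr0 => [|m mj].
    rewrite {2}/tau glue1 fderivD fderiv_fvar eqxx fderiv_embed_off ?(off_e1 cover) //.
    rewrite addr0 mulr1 subst_comp // -[RHS](crit j); apply: eq_subst => q.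
    case: (indexP q) => -[l ->]; rewrite /tau !(glue1, glue2).
      by rewrite substD [subst rho (fvar _)](rho_e1 _ cover) add0r restr_embed.
    exact: subst_restr_e.
  rewrite substM; case: (indexP m) mj => -[q ->] mj; rewrite {2}/tau (glue1, glue2).
    rewrite fderivD fderiv_fvar eq_sym (negPf mj) fderiv_embed_off ?(off_e1 cover) //.
    by rewrite addr0 subst0 mulr0.
  by rewrite fderiv_fvar eq_sym (negPf mj) subst0 mulr0.
have := second_order_split e2_inj rD rdD; rewrite (sum_off e1_inj cover).
under eq_bigr do rewrite (sum_off e1_inj cover).
set q := divided (off e2); move=> DE.
pose d l m : fps K n := glue (fun i => glue
  (fun j => (2%:R * a i * (2%:R * a j))^-1 *: q (e1 j) (q (e1 i) D)) (fun=> 0) m) (fun=> 0) l.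
have dP (Pr : fps K n -> Prop) : Pr 0 -> (forall i j, Pr (d (e1 i) (e1 j))) ->
    forall l m, Pr (d l m).
  move=> P0 P1 l m; case: (indexP l) => -[i ->]; last by rewrite /d glue2.
  by case: (indexP m) => -[j ->] //; rewrite /d glue1 glue2.
have d1 l m : coef (d l m) 0 = 0.
  apply: (dP (fun h => coef h 0 = 0)) => // i j; apply/ordge1P; rewrite /d !glue1.
  by apply: ordgeZ; do 2!apply: ordge_divided.
have cd l m : convergent v (d l m).
  apply: dP => [|i j]; first exact: convergent0.
  by rewrite /d !glue1; apply: convergentZ; do 2!apply: convergent_divided.
have := absorb n2 cn cd (or_introl d1).
rewrite (_ : \sum_l _ = D) => [fn|].
  exists a, g; split=> //; apply: (@requiv_trans _ _ _ _ _ f1); first by exists la.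
  apply: (@requiv_trans _ _ _ _ _ f2'); first by exists tau.
  by apply: requiv_sym; move: fn; rewrite addrC subrK.
rewrite sumE [X in _ + X]big1 ?addr0 => [|l _]; last first.
  by apply: big1 => m _; rewrite /d glue2 mul0r.
rewrite [RHS]DE; apply: eq_bigr => i _; rewrite sumE [X in _ + X]big1 ?addr0 => [|l _].
  apply: eq_bigr => j _; rewrite /d !glue1 !normal_fderiv1 //.
  rewrite -scalerAl -[_ *: fvar (e1 i) * _]scalerAl -!scalerAr !scalerA -mulrA mulVf.
    by rewrite scale1r mulrC.
  by rewrite !mulf_neq0.
by rewrite /d glue1 glue2 mul0r.
Qed.

End Existence.

(** * Subrings of convergent series *)

(** [A] stands for the ring of convergent series as well as for the ring of all
    formal power series, with [v] the trivial valuation in the latter case. *)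
Section Transfer.
Local Open Scope classical_set_scope.
Variables (R : realType) (K : fieldType) (v : realValuation R K) (n : nat).
Variables (A : comAlgType K) (iota : {lrmorphism A -> fps K n}) (x : 'I_n -> A).
Hypotheses (iota_inj : injective iota) (iota_conv : forall a, convergent v (iota a))
  (iota_surj : forall f, convergent v f -> exists a, iota a = f)
  (iota_x : forall i, iota (x i) = fvar i).

Lemma hadamard_sub a : exists q, (forall i, iota (q i) = divided predT i (iota a)) /\
  a = (coef (iota a) 0)%:A + \sum_i x i * q i.
Proof.
have /choice[q qE] : forall i, exists q, iota q = divided predT i (iota a).
  by move=> i; apply/iota_surj/convergent_divided/iota_conv.
exists q; split=> //; apply: iota_inj.
rewrite rmorphD /= linearZZ rmorph1 rmorph_sum [LHS]hadamard; congr (_ + _).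
by apply: eq_bigr => i _; rewrite rmorphM /= iota_x qE.
Qed.

Lemma max_idealP a : max_ideal x a <-> ordge 1 (iota a).
Proof.
split=> [[r [c [s [xs ->]]]]|a1].
  rewrite rmorph_sum; apply: ordge_sum => j _; rewrite rmorphM /=; apply: ordgeMl.
  by have [i _ <-] := xs j; rewrite iota_x; apply: ordge_fvar.
have [q [_ aE]] := hadamard_sub a; exists n, q, x; split=> [j|]; first by exists j.
rewrite aE (ordge1P _).1 // scale0r add0r; apply: eq_bigr => j _; exact: mulrC.
Qed.

(** Division by variables stays within the convergent series. *)
Lemma ideal_expP N a : ideal_exp (max_ideal x) N a <-> ordge N (iota a).
Proof.
elim: N a => [|N IH] a; first by split.
split=> [[r [c [s [xs ->]]]]|aN].
  rewrite rmorph_sum; apply: ordge_sum => j _; rewrite rmorphM /=; apply: ordgeMl.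
  have [b [d [/max_idealP b1 /IH dN ->]]] := xs j.
  by rewrite rmorphM; apply: (@ordgeM _ _ 1).
have [q [qE aE]] := hadamard_sub a.
exists n, (fun=> 1), (fun i => x i * q i); split=> [j|].
  exists (x j), (q j); split=> //; first by apply/max_idealP; rewrite iota_x; apply: ordge_fvar.
  by apply/IH; rewrite qE; apply: ordge_divided.
rewrite {1}aE aN ?mdeg0 // scale0r add0r; apply: eq_bigr => j _; by rewrite mul1r.
Qed.

(** A local automorphism is the substitution of the images [p] of the variables;
    writing the variables themselves as images shows that the Jacobian matrix
    of [p] is invertible. The converse is the inverse function theorem. *)
Lemma right_equivP f g : right_equiv x f g <-> requiv v (iota f) (iota g).
Proof.
split=> [[phi [[h hK Kh] phim <-]]|[phi cphi eqn]].
  pose p i := iota (phi (x i)).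
  have p1 i : ordge 1 (p i).
    apply/max_idealP/phim; exists (x i) => //; apply/max_idealP.
    by rewrite iota_x; apply: ordge_fvar.
  have pE a : iota (phi a) = subst p (iota a).
    have hadA (b : A) : exists c q, b = c%:A + \sum_i x i * q i.
      by have [q [_ bE]] := hadamard_sub b; exists (coef (iota b) 0), q.
    apply: (local_hom_eq hadA (phi := iota \o phi) (psi := subst p \o iota)) => i /=.
      by rewrite iota_x subst_fvar.
    exact: p1.
  exists p; last by rewrite -pE.
  split=> [//|i|]; first exact: iota_conv.
  have : jac (fun i => iota (h (x i))) *m jac p = 1%:M.
    rewrite -jac_subst // -(jac_fvar K n); congr jac; apply/funext => i.
    by rewrite -pE Kh iota_x.
  by move/mulmx1_unit => [].
have lift phi' : coord_change v phi' ->
    exists F : A -> A, forall a, iota (F a) = subst phi' (iota a).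
  move=> [p1 cp _]; have h a : exists b, iota b = subst phi' (iota a).
    by apply: iota_surj; apply: convergent_subst => //; apply: iota_conv.
  by have [F FE] := choice h; exists F.
have [psi [cpsi K1 K2]] := inverse_function cphi.
have [F FE] := lift _ cphi; have [G GE] := lift _ cpsi.
have FG : cancel F G by move=> a; apply: iota_inj; rewrite GE FE K1.
have GF : cancel G F by move=> a; apply: iota_inj; rewrite FE GE K2.
have F_add : zmod_morphism F.
  by move=> a b; apply: iota_inj; rewrite rmorphB /= !FE rmorphB substB.
have F_mul : monoid_morphism F.
  split=> [|a b]; apply: iota_inj; first by rewrite FE rmorph1 subst1.
  by rewrite rmorphM /= !FE rmorphM substM.
have F_scal : scalable F.
  by move=> c a; apply: iota_inj; rewrite FE !linearZZ /= FE.
pose m1 := GRing.isZmodMorphism.Build A A F F_add.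
pose m2 := GRing.isMonoidMorphism.Build A A F F_mul.
pose m3 := GRing.isScalable.Build K A A *:%R F F_scal.
pose FL : {lrmorphism A -> A} := HB.pack F m1 m2 m3.
exists FL; split; first by exists G.
- move=> _ [a /max_idealP a1 <-]; apply/max_idealP; rewrite /= FE.
  exact: ordge_subst.
- by apply: iota_inj; rewrite /= FE.
Qed.

End Transfer.

Section LastVariables.
Variables (K : fieldType) (k n : nat) (hk : (k <= n)%N).

Lemma widen_ord_inj : injective (widen_ord hk).
Proof. by move=> i j /(congr1 val)/= /val_inj. Qed.

Lemma last_ord_inj : injective (last_ord hk).
Proof. by move=> i j /(congr1 val) /= /addnI/val_inj. Qed.

Lemma last_cover i : off (last_ord hk) i = (i \in codom (widen_ord hk)).
Proof.
rewrite /off; have [ik|ki] := ltnP i k.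
  have -> : i = widen_ord hk (Ordinal ik) by apply/val_inj.
  rewrite codom_f; apply/codomP => -[j /(congr1 val) /= e].
  by move: ik; rewrite e ltnNge leq_addr.
have lt : (i - k < n - k)%N by rewrite ltn_sub2r // (leq_ltn_trans ki).
have -> : i = last_ord hk (Ordinal lt) by apply/val_inj; rewrite /= subnKC.
rewrite codom_f; apply/esym/codomP => -[j /(congr1 val) /= e].
by have := ltn_ord j; rewrite -e subnKC // ltnNge ki.
Qed.

Lemma fembedE (g : fps K (n - k)) : fembed hk g = subst (fvar \o last_ord hk) g.
Proof.
apply/fpsP => a; rewrite coef_embed; last exact: last_ord_inj.
rewrite /= (_ : mfree hk a = ~~ [exists i, off (last_ord hk) i && (0 < a i)%N]).
  by case: existsP.
rewrite negb_exists; apply/forallP/forallP => h i.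
  rewrite last_cover; apply/negP => /andP[/codomP[j ->]].
  by rewrite (eqP (h j)).
by have := h (widen_ord hk i); rewrite last_cover codom_f lt0n negbK.
Qed.

End LastVariables.

Section DiagonalForm.
Variables (K : fieldType) (k n : nat) (hk : (k <= n)%N) (A : comAlgType K)
  (iota : {lrmorphism A -> fps K n}) (x : 'I_n -> A).
Hypothesis iota_x : forall i, iota (x i) = fvar i.

Lemma diag_formE a : iota (diag_form hk x a) = quad (widen_ord hk) a.
Proof.
by rewrite linear_sum; apply: eq_bigr => i _; rewrite linearZZ /= rmorphXn /= iota_x.
Qed.

End DiagonalForm.

Theorem theorem2p1 (R : realType) (K : fieldType) (v : realValuation R K)
    (char_neq2 : 2%N \notin [pchar K]) (k n : nat) (hk : (k <= n)%N) :
  (forall (a : 'I_k -> K) (g0 g1 : cps v (n - k)) (f0 f1 : cps v n),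
      (forall i, a i != 0) ->
      ideal_exp (max_ideal cvar) 3 g0 ->
      ideal_exp (max_ideal cvar) 3 g1 ->
      ideal_exp (max_ideal cvar) 2 f0 ->
      ideal_exp (max_ideal cvar) 2 f1 ->
      f0 = diag_form hk cvar a + cembed hk g0 ->
      f1 = diag_form hk cvar a + cembed hk g1 ->
      right_equiv cvar f0 f1 ->
      right_equiv cvar g0 g1)
  /\
  (forall f : fps K n,
      ideal_exp (max_ideal fvar) 2 f ->
      \rank (hessian f) = k ->
      (exists (a : 'I_k -> K) (g : fps K (n - k)),
          [/\ forall i, a i != 0,
              ideal_exp (max_ideal fvar) 3 g
            & right_equiv fvar f (diag_form hk fvar a + fembed hk g)]) /\
      (forall (a a' : 'I_k -> K) (g g' : fps K (n - k)),
          (forall i, a i != 0) -> (forall i, a' i != 0) ->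
          ideal_exp (max_ideal fvar) 3 g ->
          ideal_exp (max_ideal fvar) 3 g' ->
          right_equiv fvar f (diag_form hk fvar a + fembed hk g) ->
          right_equiv fvar f (diag_form hk fvar a' + fembed hk g') ->
          right_equiv fvar g g'))
  /\
  (forall f : cps v n,
      ideal_exp (max_ideal cvar) 2 f ->
      isolated_singularity f ->
      \rank (hessian (cval f)) = k ->
      (exists (a : 'I_k -> K) (g : cps v (n - k)),
          [/\ forall i, a i != 0,
              ideal_exp (max_ideal cvar) 3 g
            & right_equiv cvar f (diag_form hk cvar a + cembed hk g)]) /\
      (forall (a a' : 'I_k -> K) (g g' : cps v (n - k)),
          (forall i, a i != 0) -> (forall i, a' i != 0) ->
          ideal_exp (max_ideal cvar) 3 g ->
          ideal_exp (max_ideal cvar) 3 g' ->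
          right_equiv cvar f (diag_form hk cvar a + cembed hk g) ->
          right_equiv cvar f (diag_form hk cvar a' + cembed hk g') ->
          right_equiv cvar g g')).
Proof.
have w_inj := @widen_ord_inj _ _ hk; have l_inj := @last_ord_inj _ _ hk.
have cov := @last_cover _ _ hk.
have c_inj m : injective (@cval _ _ v m) by exact: val_inj.
have c_conv m := @cval_convergent _ _ v m.
have c_surj m (f : fps K m) : convergent v f -> exists a : cps v m, cval a = f.
  by move=> cf; exists (to_cps cf).
have c_exp m N (f : cps v m) : ideal_exp (max_ideal cvar) N f <-> ordge N (cval f).
  exact: (ideal_expP (iota := @cval _ _ v m) (@c_inj m) (c_conv m) (c_surj m)).
have c_eq m (f g : cps v m) : right_equiv cvar f g <-> requiv v (cval f) (cval g).
  exact: (right_equivP (iota := @cval _ _ v m) (@c_inj m) (c_conv m) (c_surj m)).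
have c_normal a (g : cps v (n - k)) : cval (diag_form hk cvar a + cembed hk g)
    = normal (widen_ord hk) (last_ord hk) a (cval g).
  by rewrite rmorphD /= (diag_formE hk (iota := @cval _ _ v n)) // fembedE.
pose w := trivial_valuation R K.
have f_conv m (f : fps K m) : convergent w f by exact: convergent_trivial.
have f_exp m N (f : fps K m) : ideal_exp (max_ideal fvar) N f <-> ordge N f.
  by apply: (ideal_expP (iota := idfun) _ (@f_conv m)) => // h; exists h.
have f_eq m (f g : fps K m) : right_equiv fvar f g <-> requiv w f g.
  by apply: (right_equivP (iota := idfun) _ (@f_conv m)) => // h; exists h.
have f_normal a (g : fps K (n - k)) : diag_form hk fvar a + fembed hk g
    = normal (widen_ord hk) (last_ord hk) a g.
  by rewrite fembedE.
split; [|split].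
- move=> a g0 g1 f0 f1 a0 /c_exp g03 /c_exp g13 _ _ -> -> /c_eq.
  rewrite !c_normal => e; apply/c_eq.
  exact: (residual_unique char_neq2 w_inj l_inj cov a0 a0 g03 g13 (c_conv _ g0) e).
- move=> f /f_exp f2 rH; split=> [|a a' g g' a0 a'0 /f_exp g3 /f_exp g'3 /f_eq e /f_eq e'].
    have [a [g [a0 g3 _ e]]] :=
      normal_form char_neq2 w_inj l_inj cov f2 (@f_conv _ f) rH.
    by exists a, g; split=> //; [apply/f_exp | apply/f_eq; rewrite f_normal].
  apply/f_eq; move: e e'; rewrite !f_normal => /requiv_sym e e'.
  exact: (residual_unique char_neq2 w_inj l_inj cov a0 a'0 g3 g'3 (@f_conv _ g)
    (requiv_trans e e')).
move=> f /c_exp f2 _ rH; split=> [|a a' g g' a0 a'0 /c_exp g3 /c_exp g'3 /c_eq e /c_eq e'].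
  have [a [g [a0 g3 /c_surj[g' gE] e]]] :=
    normal_form char_neq2 w_inj l_inj cov f2 (c_conv _ f) rH.
  rewrite -gE in g3 e; exists a, g'.
  by split=> //; [apply/c_exp | apply/c_eq; rewrite c_normal].
apply/c_eq; move: e e'; rewrite !c_normal => /requiv_sym e e'.
exact: (residual_unique char_neq2 w_inj l_inj cov a0 a'0 g3 g'3 (c_conv _ g)
  (requiv_trans e e')).
Qed.
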